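(* Let $\gamma_n\in\mathbb{R}^p$ with $\gamma_{n,j}\ge0$ for all $j$, let $\Gamma_n=\mathrm{diag}(\gamma_n)$, and let the tuning parameters be $\lambda_n = \hat\sigma\gamma_n$. If $M_n\subseteq\mathbb{R}^p$ is a non-random Borel set satisfying Condition A with matrix $\bar C = C_n$, then $$\inf_{\beta\in\mathbb{R}^p}P_\beta\left(\beta\in\hat\beta_L - n^{-1/2}\hat\sigma M_n\right) = \min_{d\in\{-1,1\}^p}P(\hat u_n^d\in\hat\sigma M_n) = \min_{d\in\{-1,1\}^p}P(\hat t_n^d\in M_n),$$ where $\hat t_n^d\sim T(n-p,\ -n^{-1/2}C_n^{-1}\Gamma_nd,\ C_n^{-1})$.
   Context: Model: $y = X\beta + \varepsilon$, where $X$ is a non-random real $n\times p$ matrix of full column rank $p$, $n>p$, $\beta \in \mathbb{R}^p$ is the unknown parameter, and $\varepsilon \sim N(0,\sigma^2 I_n)$ with $\sigma^2>0$. $P_\beta$ denotes probability when the true parameter is $\beta$. Let $\hat\beta_{LS}$ be the least-squares estimator, $\hat\varepsilon_{LS} = y-X\hat\beta_{LS}$, $\hat\sigma^2 = \frac{1}{n-p}\hat\varepsilon_{LS}'\hat\varepsilon_{LS}$, and $\hat\sigma = \sqrt{\hat\sigma^2}$. With (data-dependent) tuning parameters $\lambda_n = (\lambda_{n,1},\dots,\lambda_{n,p})'$, the Lasso estimator $\hat\beta_L$ is the unique minimizer over $b \in \mathbb{R}^p$ of $\|y - Xb\|^2 + 2\sum_{j=1}^p \lambda_{n,j}|b_j|$.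 Put $C_n = X'X/n$, $W_n = n^{-1/2}X'\varepsilon$. For $d \in \{-1,1\}^p$, $\hat u_n^d$ is the unique minimizer over $u\in\mathbb{R}^p$ of $u'C_nu - 2u'W_n + 2n^{-1/2}\sum_{j=1}^p \lambda_{n,j}d_ju_j$. Notation: $a - cM = \{a-cm : m\in M\}$. $T(k,\mu,\Sigma)$, with $k$ degrees of freedom, $\mu\in\mathbb{R}^p$ and positive definite $\Sigma\in\mathbb{R}^{p\times p}$, is the distribution on $\mathbb{R}^p$ with Lebesgue density $$f(t) = \frac{\Gamma(\frac{k+p}{2})}{\Gamma(\frac k2)(k\pi)^{p/2}|\Sigma|^{1/2}}\left(1+\frac{(t-\mu)'\Sigma^{-1}(t-\mu)}{k}\right)^{-\frac{k+p}{2}},$$ where $\Gamma(\cdot)$ is the Gamma function. For $m \in \mathbb{R}^p$, $d \in \{-1,1\}^p$ and $\bar C \in \mathbb{R}^{p\times p}$ let $A^d_{\bar C}(m) = \bigcap_{j=1}^p\{z \in \mathbb{R}^p : d_j(\bar Cm)_j \le d_j(\bar Cz)_j,\ d_jz_j \le 0\}$. A set $M\subseteq \mathbb{R}^p$ satisfies Condition A with matrix $\bar C$ if $A^d_{\bar C}(m) \subseteq M$ for all $d \in \{-1,1\}^p$ and all $m \in M$. *)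

(* Defs.v *)
From HB Require Import structures.
From mathcomp Require Import all_boot all_order all_algebra.
From mathcomp Require Import all_classical all_reals all_analysis.
From mathcomp Require Import measurable_realfun.

Set Implicit Arguments.
Unset Strict Implicit.
Unset Printing Implicit Defensive.

Import Order.TTheory GRing.Theory Num.Theory.
Import numFieldNormedType.Exports.

Local Open Scope classical_set_scope.
Local Open Scope ring_scope.

Definition borel_col_display : measure_display. Proof. exact. Qed.

Section borel_col.
Context {R : realType} {n : nat}.

Definition borel_col : set (set 'cV[R]_n) := <<s [set U | open U] >>.

Let borel_col0 : borel_col set0.
Proof. exact: sigma_algebra0. Qed.

Let borel_colC A : borel_col A -> borel_col (~` A).
Proof. exact: sigma_algebraC. Qed.

Let borel_col_bigcup (F : (set 'cV[R]_n)^nat) :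
  (forall i, borel_col (F i)) -> borel_col (\bigcup_i F i).
Proof. exact: sigma_algebra_bigcup. Qed.

HB.instance Definition _ := @isMeasurable.Build borel_col_display
  'cV[R]_n borel_col borel_col0 borel_colC borel_col_bigcup.

End borel_col.

Section measurable_col.
Context {R : realType}.

Lemma measurable_coord n (i : 'I_n) :
  measurable_fun [set: 'cV[R]_n] (fun v => v i 0).
Proof.
apply: (measurability _ (RGenOpens.measurableE R)).
move=> _ [_ [a [b ->]] <-]; rewrite setTI; apply: sub_sigma_algebra => /=.
apply: open_comp; last exact: interval_open.
by move=> v _; exact: coord_continuous.
Qed.

Lemma measurable_fun_col d (T : measurableType d) n (f : T -> 'cV[R]_n) :
  (forall i, measurable_fun setT (fun t => f t i 0)) -> measurable_fun setT f.
Proof.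
move=> mf; apply: (measurability [set U : set 'cV[R]_n | open U]) => //.
move=> _ [U oU <-]; rewrite setTI.
pose box (q : 'cV[rat]_n * nat) : set 'cV[R]_n :=
  [set v | forall i, `|ratr (q.1 i 0) - v i 0| < q.2.+1%:R^-1].
pose F q : set T := if `[< box q `<=` U >] then f @^-1` box q else set0.
have -> : f @^-1` U = \bigcup_q F q.
  apply/seteqP; split=> [t Ut|t [q _]]; last first.
    by rewrite /F; case: asboolP => // sU /sU.
  have /nbhs_ballP[e /= e0 eU] : nbhs (f t) U by exact: open_nbhs_nbhs.
  have [k ke] : exists k, k.+1%:R^-1 < e / 2.
    have e20 : 0 < e / 2 by rewrite divr_gt0.
    have [k _ /(_ k (leqnn _)) kP] := near_infty_natSinv_lt (PosNum e20).
    by exists k.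
  have k0 : (0 : R) < k.+1%:R^-1 by rewrite invr_gt0.
  have qP i : exists q : rat, `|ratr q - f t i 0| < k.+1%:R^-1.
    have /rat_in_itvoo[q] : f t i 0 - k.+1%:R^-1 < f t i 0 + k.+1%:R^-1.
      by rewrite ltrD2l (lt_trans _ k0)// oppr_lt0.
    rewrite in_itv/= => /andP[q1 q2]; exists q.
    by rewrite distrC ltr_distlC q1 q2.
  have [g gP] := choice qP.
  have tbox : box (\col_i g i, k) (f t) by move=> i; rewrite /= mxE.
  exists (\col_i g i, k) => //; rewrite /F; case: asboolP => //; case => v vb.
  apply: eU; split => // i j; rewrite ord1 /ball/=.
  rewrite -[f t i 0](subrK (ratr (g i))) -addrA (le_lt_trans (ler_normD _ _))//.
  rewrite (splitr e) ltrD//; last first.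
    by have := vb i; rewrite /= mxE => /lt_trans; exact.
  by rewrite distrC (lt_trans (gP i)).
apply: countable_bigcupT_measurable => [|q]; first exact: countableP.
rewrite /F; case: asboolP => // _.
have -> : f @^-1` box q =
    \bigcap_(i in [set: 'I_n]) [set t | `|ratr (q.1 i 0) - f t i 0| < q.2.+1%:R^-1].
  by apply/seteqP; split=> [t tq i _|t tq i]; [exact: tq|exact: (tq i I)].
apply: fin_bigcap_measurable => [|i _]; first exact: finite_finset.
have mg : measurable_fun [set: T] (fun t => `|ratr (q.1 i 0) - f t i 0|).
  by apply: measurableT_comp => //; exact: measurable_funB.
have := mg measurableT _ (measurable_itv `]-oo, q.2.+1%:R^-1[).
by rewrite setTI.
Qed.

Definition cons_col n (z : 'cV[R]_n * measurableTypeR R) : 'cV[R]_n.+1 :=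
  col_mx (z.2 : R)%:M z.1.

Lemma cons_col0 n (z : 'cV[R]_n * measurableTypeR R) : cons_col z ord0 0 = z.2.
Proof.
rewrite /cons_col (_ : (ord0 : 'I_n.+1) = lshift n (ord0 : 'I_1)); last exact/val_inj.
by rewrite (@col_mxEu _ 1 n 1) mxE.
Qed.

Lemma cons_colS n (z : 'cV[R]_n * measurableTypeR R) i :
  cons_col z (lift ord0 i) 0 = z.1 i 0.
Proof. by rewrite /cons_col -rshift1 (@col_mxEd _ 1 n 1). Qed.

Lemma measurable_cons_col n : measurable_fun setT (@cons_col n).
Proof.
apply: measurable_fun_col => i; case: (unliftP ord0 i) => [j|] ->.
  under eq_fun do rewrite cons_colS.
  exact: measurableT_comp (measurable_coord j) measurable_fst.
under eq_fun do rewrite cons_col0.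
exact: measurable_snd.
Qed.

End measurable_col.

Section lebesgue_col.
Context {R : realType}.

Definition lebesgue_cons n (mu : {measure set 'cV[R]_n -> \bar R}) :
    set 'cV[R]_n.+1 -> \bar R :=
  pushforward (mu \x @lebesgue_measure R)%E (@cons_col R n).

HB.instance Definition _ n (mu : {measure set 'cV[R]_n -> \bar R}) :=
  Measure.copy (lebesgue_cons mu)
    (measure_function_pushforward__canonical__measure_function_Measure
      (mu \x @lebesgue_measure R)%E (@measurable_cons_col R n)).

(* Lebesgue measure on the Borel sets of R^n, as an iterated product measure. *)
Fixpoint lebesgue_col n : {measure set 'cV[R]_n -> \bar R} :=
  if n is m.+1 then lebesgue_cons (lebesgue_col m) else \d_(0 : 'cV[R]_0).

Lemma lebesgue_col_box n (A : 'I_n -> set (measurableTypeR R)) :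
  (forall i, measurable (A i)) ->
  lebesgue_col n [set v | forall i, A i (v i 0)] =
  (\prod_(i < n) lebesgue_measure (A i))%E.
Proof.
elim: n A => [|n ih] A mA.
  by rewrite big_ord0 /= diracE mem_set// => -[].
pose B := [set v : 'cV[R]_n | forall i : 'I_n, A (lift ord0 i) (v i 0)].
have mB : measurable B.
  rewrite [X in measurable X](_ : _ = \bigcap_(i in [set: 'I_n])
      (fun v : 'cV[R]_n => v i 0) @^-1` A (lift ord0 i)); last first.
    by apply/seteqP; split=> [v vA i _|v vA i]; [exact: vA|exact: (vA i I)].
  apply: fin_bigcap_measurable => [|i _]; first exact: finite_finset.
  by have := @measurable_coord R n i measurableT _ (mA (lift ord0 i)); rewrite setTI.
rewrite big_ord_recl muleC -(ih (A \o lift ord0) (fun i => mA _)).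
transitivity ((lebesgue_col n \x @lebesgue_measure R)%E
    (B `*` A ord0)); last first.
  exact: product_measure1E.
rewrite /= /lebesgue_cons /pushforward; congr (product_measure1 _ _ _).
apply/seteqP; split=> -[v x] /=.
  move=> vA; split=> [i|]; first by have := vA (lift ord0 i); rewrite cons_colS.
  by have := vA ord0; rewrite cons_col0.
move=> [vA xA] i; case: (unliftP ord0 i) => [j|] ->; first by rewrite cons_colS.
by rewrite cons_col0.
Qed.

End lebesgue_col.

Section distributions.
Context {R : realType}.

(* Only meaningful for [0 < a]: [Rintegral] returns 0 if the integral diverges. *)
Definition gamma_fun (a : R) : R :=
  \int[lebesgue_measure]_(x in `]0, +oo[) (x `^ (a - 1) * expR (- x)).

Definition quad_form n (A : 'M[R]_n) (v : 'cV[R]_n) : R := (v^T *m A *m v) 0 0.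

Definition mvnormal_pdf n (mu : 'cV[R]_n) (Sigma : 'M[R]_n) (x : 'cV[R]_n) : R :=
  ((pi *+ 2) `^ (n%:R / 2) * Num.sqrt (\det Sigma))^-1 *
  expR (- (quad_form (invmx Sigma) (x - mu) / 2)).

Definition mvnormal_prob n (mu : 'cV[R]_n) (Sigma : 'M[R]_n)
    (A : set 'cV[R]_n) : \bar R :=
  (\int[lebesgue_col n]_(x in A) (mvnormal_pdf mu Sigma x)%:E)%E.

(* [Sigma] is the scale matrix, not the covariance. *)
Definition mvt_pdf (k : nat) p (mu : 'cV[R]_p) (Sigma : 'M[R]_p) (t : 'cV[R]_p) : R :=
  gamma_fun ((k + p)%:R / 2) /
    (gamma_fun (k%:R / 2) * (k%:R * pi) `^ (p%:R / 2) * Num.sqrt (\det Sigma)) *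
  (1 + quad_form (invmx Sigma) (t - mu) / k%:R) `^ (- ((k + p)%:R / 2)).

Definition mvt_prob (k : nat) p (mu : 'cV[R]_p) (Sigma : 'M[R]_p)
    (A : set 'cV[R]_p) : \bar R :=
  (\int[lebesgue_col p]_(t in A) (mvt_pdf k mu Sigma t)%:E)%E.

End distributions.

Section lasso.
Context {R : realType}.

(* [0] if [f] has no unique minimizer. *)
Definition argmin p (f : 'cV[R]_p -> R) : 'cV[R]_p :=
  xget 0 [set b | forall b', b' != b -> f b < f b'].

(* The sup norm [`|v|] of the library is not the Euclidean one. *)
Definition sqnorm n (v : 'cV[R]_n) : R := \sum_(i < n) v i 0 ^+ 2.

Definition sign_vec p (s : {ffun 'I_p -> bool}) : 'cV[R]_p :=
  \col_j (-1) ^+ s j.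

Variables (n p : nat) (X : 'M[R]_(n, p)).

Definition ls_estimator (y : 'cV[R]_n) : 'cV[R]_p :=
  argmin (fun b => sqnorm (y - X *m b)).

Definition sigma_hat (y : 'cV[R]_n) : R :=
  Num.sqrt (sqnorm (y - X *m ls_estimator y) / (n - p)%:R).

Definition lasso (lambda : 'cV[R]_p) (y : 'cV[R]_n) : 'cV[R]_p :=
  argmin (fun b =>
    sqnorm (y - X *m b) + 2 * \sum_(j < p) lambda j 0 * `|b j 0|).

Definition gram_mx : 'M[R]_p := n%:R^-1 *: (X^T *m X).

Definition score (eps : 'cV[R]_n) : 'cV[R]_p :=
  (Num.sqrt n%:R)^-1 *: (X^T *m eps).

(* Lasso objective in u = sqrt n (b - beta), with |b_j| replaced by d_j b_j and
   constants dropped. *)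
Definition u_hat (lambda d : 'cV[R]_p) (eps : 'cV[R]_n) : 'cV[R]_p :=
  argmin (fun u =>
    quad_form gram_mx u - 2 * (u^T *m score eps) 0 0 +
    2 * (Num.sqrt n%:R)^-1 * \sum_(j < p) lambda j 0 * d j 0 * u j 0).

End lasso.

Definition condA_set (R : realType) p (C : 'M[R]_p) (d m : 'cV[R]_p) :
    set 'cV[R]_p :=
  [set z | forall j, d j 0 * (C *m m) j 0 <= d j 0 * (C *m z) j 0 /\
                     d j 0 * z j 0 <= 0].

Definition conditionA (R : realType) p (C : 'M[R]_p) (M : set 'cV[R]_p) : Prop :=
  forall (s : {ffun 'I_p -> bool}) m, M m -> condA_set C (sign_vec s) m `<=` M.

(* Main.v *)
Require Import Defs.
From HB Require Import structures.
From mathcomp Require Import all_boot all_order all_fingroup all_algebra.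
From mathcomp Require Import all_classical all_reals all_analysis.
From mathcomp Require Import measurable_realfun.
From mathcomp Require Import ring lra.

Set Implicit Arguments.
Unset Strict Implicit.
Unset Printing Implicit Defensive.

Import Order.TTheory GRing.Theory Num.Theory.
Import numFieldNormedType.Exports.

Local Open Scope classical_set_scope.
Local Open Scope ring_scope.

(** For each parameter the coverage event contains the one of a suitable orthant
    minimizer [u_hat], and it becomes that event when the parameter goes to
    infinity in the orthant; the law of the orthant minimizer is computed.

    Let [b] be the Lasso estimator, [s] the scale estimate and
    [u = sqrt n (b - beta)], so that the coverage event says [u \in s M]. The
    scale estimate depends on the residuals, hence on the errors only
    ([sigma_hat_shift]). Stationarity reads [C u = W - r / sqrt n], where [r] is a
    subgradient of the penalty at [b]: it satisfies [|r_j| <= lam_j], and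
    [r_j = lam_j sgn b_j] if [b_j != 0]. For the orthant minimizer [u^d] the
    same equation holds with [r_j = lam_j d_j].

    Lower bound: given [beta], take for [d] its signs. In the coordinates where
    [u_j d_j > 0], also [b_j d_j > 0], and the subgradients of both problems
    coincide. In the others [d_j r_j <= lam_j]. Flipping [d] in the former
    coordinates gives signs [d'] for which, if [s != 0], [u / s] lies in the set that
    Condition A attaches to [d'] and [u^d / s]. Hence [u^d \in s M] implies [u \in s M]
    ([coverage_lower]), and the coverage probability at [beta] is at least the
    probability for one of the [d].

    Upper bound: when [beta] goes to infinity along the direction [d], every
    realization eventually has [b] in the open orthant of [d], where [u = u^d]
    ([lasso_error_far]). By continuity of the measure the infimum is at most the
    probability for each [d] ([lasso_coverage_inf_le]). The events are measurable
    because the Lasso is a Lipschitz function of [X^T y] and the penalty levels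
    ([lasso_kkt_lip]).

    Distribution: since the penalty levels are proportional to [s], the quotient
    [u^d / s] is the studentized least-squares error plus a constant vector
    ([u_hat_split]). Choose [B] of full rank with [X^T B = 0]. In the coordinates
    [(v, z)] given by [eps = X v + B z], the normal density is a product, the
    least-squares error is [v], and [s] is a quadratic norm of [z]. Substituting
    the studentized vector [t] for [v] with [z] fixed, and then rescaling [z],
    shows that the law of [t] has a density proportional to
    [(1 + q(t - m) / k)^-((k + p) / 2)], with [q] the form of the Gram matrix and
    [k = n - p] ([ratio_law]). No constant is followed through this computation:
    it is found from the total mass, which is one for the law of [t] and also for
    the t density ([integral_mvt_pdf]). The latter is obtained by writing the power
    as a Gamma integral of Gaussian functions and integrating those first.

    Both computations rest on the linear change of variables for the iterated
    Lebesgue measure, proved by Gaussian elimination ([linear_change_unit]). *)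

(** * Lebesgue measure on columns *)
Section lebesgue_col_theory.
Context {R : realType}.
Implicit Types (n : nat).

Definition box n (A : 'I_n -> set (measurableTypeR R)) : set 'cV[R]_n :=
  [set v | forall i, A i (v i 0)].

Lemma measurable_box n (A : 'I_n -> set (measurableTypeR R)) :
  (forall i, measurable (A i)) -> measurable (box A).
Proof.
move=> mA; rewrite [X in measurable X](_ : _ = \bigcap_(i in [set: 'I_n])
    (fun v : 'cV[R]_n => v i 0) @^-1` A i); last first.
  by apply/seteqP; split=> [v vA i _|v vA i]; [exact: vA|exact: (vA i I)].
apply: fin_bigcap_measurable => [|i _]; first exact: finite_finset.
by have := @measurable_coord R n i measurableT _ (mA i); rewrite setTI.
Qed.

Definition boxes n : set (set 'cV[R]_n) :=
  [set B | exists A : 'I_n -> set (measurableTypeR R),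
     (forall i, measurable (A i)) /\ B = box A].

(** A map into ['cV_n] is measurable as soon as its coordinates are, in
    particular the identity map from the sigma-algebra that boxes generate. *)
Lemma boxesE n : @measurable _ 'cV[R]_n = <<s @boxes n >>.
Proof.
apply/seteqP; split; last first.
  apply: smallest_sub; first exact: sigma_algebra_measurable.
  by move=> _ [A [mA ->]]; exact: measurable_box.
have mid : measurable_fun [set: g_sigma_algebraType (@boxes n)]
    (fun v : g_sigma_algebraType (@boxes n) => (v : 'cV[R]_n)).
  apply: measurable_fun_col => i _ B mB; rewrite setTI.
  apply: sub_sigma_algebra.
  exists (fun j => if j == i then B else setT); split.
    by move=> j; case: ifP => // _; exact: measurableT.
  apply/seteqP; split=> v /=; first by move=> Bv j; case: eqP => [->|].
  by move=> /(_ i); rewrite eqxx.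
move=> B mB; have := mid measurableT B mB; rewrite setTI.
by [].
Qed.

Lemma boxes_setI n : setI_closed (@boxes n).
Proof.
move=> _ _ [A [mA ->]] [B [mB ->]]; exists (fun i => A i `&` B i); split.
  by move=> i; exact: measurableI.
apply/seteqP; split=> v /=; first by case=> vA vB i; split.
by move=> vAB; split=> i; case: (vAB i).
Qed.

Definition cube n (k : nat) : set 'cV[R]_n := box (fun=> `[- k%:R, k%:R]%classic).

Lemma measurable_cube n k : measurable (@cube n k).
Proof. by apply: measurable_box => i; exact: measurable_itv. Qed.

Lemma cube_cover n : \bigcup_k (@cube n k) = setT.
Proof.
apply/seteqP; split=> // v _.
(* Any natural number above every [|v i|] will do. *)
pose k := (\sum_(i < n) Num.truncn `|v i 0%R|)%N.+1.
exists k => // i /=; rewrite in_itv/= -ler_norml.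
have := ltW (truncnS_gt `|v i 0|); move=> /le_trans; apply.
by rewrite ler_nat ltnS (bigD1 i)//= leq_addr.
Qed.

Lemma cube_fin n k : (lebesgue_col n (@cube n k) < +oo)%E.
Proof.
rewrite lebesgue_col_box => [|i]; last exact: measurable_itv.
have -> : (\prod_(i < n) lebesgue_measure (`[(- k%:R)%R, k%:R%R]%classic : set R))%E =
    (((k%:R - - k%:R) ^+ n)%:E : \bar R).
  elim: n => [|n ih]; first by rewrite big_ord0 expr0.
  rewrite big_ord_recl ih exprS EFinM lebesgue_measure_itv/= lte_fin.
  case: ifPn => // /negbTE; rewrite -subr_gt0 opprK -natrD ltr0n addn_gt0 orbb.
  case: k {ih} => // _; by rewrite oppr0 subrr !mul0r mul0e.
exact: ltry.
Qed.

(** Boxes form a generating pi-system that contains the cubes, which exhaust the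
    space: two measures with the same finite volumes on boxes are equal. *)
Lemma lebesgue_col_unique n (m : {measure set 'cV[R]_n -> \bar R}) :
  (forall A : 'I_n -> set (measurableTypeR R), (forall i, measurable (A i)) ->
     m (box A) = (\prod_(i < n) lebesgue_measure (A i))%E) ->
  forall B, measurable B -> m B = lebesgue_col n B.
Proof.
move=> mE B mB; apply/esym.
apply: (measure_unique (@boxes n) (@cube n)) => //.
- exact: boxesE.
- exact: boxes_setI.
- by move=> k; exists (fun=> `[- k%:R, k%:R]%classic); split.
- exact: cube_cover.
- by move=> _ [A [mA ->]]; rewrite mE//; exact: lebesgue_col_box.
- exact: cube_fin.
Qed.

(** A name for the Lebesgue measure to which sigma-finiteness, hence Tonelli's
    theorem, can be attached. *)
Definition leb n : set 'cV[R]_n -> \bar R := lebesgue_col n.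

HB.instance Definition _ n := Measure.copy (@leb n)
  (Measure.sort (lebesgue_col n)).

Lemma leb_sigma_finite n : sigma_finite setT (@leb n).
Proof.
exists (@cube n); first by rewrite cube_cover.
by move=> k; split; [exact: measurable_cube|exact: cube_fin].
Qed.

HB.instance Definition _ n :=
  Measure_isSigmaFinite.Build _ _ _ (@leb n) (@leb_sigma_finite n).

End lebesgue_col_theory.
Arguments leb {R} n _.

(** * Linear change of variables *)
(** The pushforward is a measure through a proof that the map is measurable,
    which this form takes as an argument. *)
Notation pushforward_measure :=
  measure_function_pushforward__canonical__measure_function_Measure.

Section linear_change_of_variables.
Context {R : realType}.
Implicit Types (n : nat).

Lemma affine_preimage_ocitv (a b c d : R) : a != 0 ->
  lebesgue_measure ((fun x => a * x + b) @^-1` `]c, d]%classic : set R) =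
  (if (c < d)%R then (`|a|^-1 * (d - c))%:E else 0%E).
Proof.
move=> a0.
have [apos|aneg|a00] := ltgtP 0 a; last by rewrite -a00 eqxx in a0.
  have -> : (fun x => a * x + b) @^-1` `]c, d] = `](c - b) / a, (d - b) / a]%classic.
    apply/seteqP; split=> x /=; rewrite !in_itv/= ltr_pdivrMr// ler_pdivlMr//;
    by rewrite ltrBlDr lerBrDr (mulrC x).
  rewrite lebesgue_measure_itv/= lte_fin ltr_pM2r ?invr_gt0// ltrBlDr subrK.
  case: ifP => // _; rewrite -EFinD -mulrBl opprB addrA subrK mulrC gtr0_norm//.
have -> : (fun x => a * x + b) @^-1` `]c, d] = `[(d - b) / a, (c - b) / a[%classic.
  apply/seteqP; split=> x /=; rewrite !in_itv/= ler_ndivrMr// ltr_ndivlMr//;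
  by rewrite ltrBlDr lerBrDr (mulrC x) andbC.
rewrite lebesgue_measure_itv/= lte_fin ltr_nM2r ?invr_lt0// ltrBlDr subrK.
case: ifP => // _; rewrite -EFinD -mulrBl opprB addrA subrK ltr0_norm//.
by rewrite invrN mulNr -mulrN opprB mulrC.
Qed.

Lemma measurable_affine1 (a b : R) :
  measurable_fun [set: measurableTypeR R]
    (fun x : measurableTypeR R => (a * x + b : measurableTypeR R)).
Proof.
by apply: measurable_funD => //; exact: measurable_funM.
Qed.

(** Both sides are measures of [A], and they agree on half-open intervals; for
    [a < 0] the preimage of such an interval is half-open on the other side. *)
Lemma lebesgue_measure_affine (a b : R) (A : set (measurableTypeR R)) :
  a != 0 -> measurable A ->
  (`|a|%:E * lebesgue_measure ((fun x => a * x + b)%R @^-1` A) =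
   lebesgue_measure A)%E.
Proof.
move=> a0 mA; have ma := measurable_affine1 a b.
pose mu := mscale (NngNum (normr_ge0 a))
  (pushforward_measure (@lebesgue_measure R) ma).
apply/esym; apply: (@lebesgue_measure_unique R mu) => // _ [[c d] _ <-].
rewrite /mu /mscale /pushforward /=.
rewrite [X in (_ = _ * X)%E](@affine_preimage_ocitv a b c d a0).
rewrite lebesgue_measure_itv/= lte_fin; case: ifP => _; last by rewrite mule0.
by rewrite -EFinD -EFinM mulrA divff ?mul1r// normr_eq0.
Qed.

Lemma integral_affine1 (a b : R) (f : R -> \bar R) : a != 0 ->
  measurable_fun setT f -> (forall x, 0 <= f x)%E ->
  (`|a|%:E * \int[lebesgue_measure]_x f (a * x + b)%R =
   \int[lebesgue_measure]_x f x)%E.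
Proof.
move=> a0 mf f0; have ma := measurable_affine1 a b.
pose mu := mscale (NngNum (normr_ge0 a))
  (pushforward_measure (@lebesgue_measure R) ma).
rewrite [RHS](@eq_measure_integral _ _ _ setT mu); last first.
  by move=> A mA _; rewrite -[LHS](lebesgue_measure_affine b a0 mA).
rewrite ge0_integral_mscale//=; congr *%E.
by rewrite ge0_integral_pushforward// preimage_setT.
Qed.

Lemma measurable_affine m n (A : 'M[R]_(m, n)) (b : 'cV[R]_m) :
  measurable_fun setT (fun v : 'cV[R]_n => A *m v + b).
Proof.
apply: measurable_fun_col => i.
under eq_fun do rewrite !mxE.
apply: measurable_funD => //; apply: measurable_sum => j.
by apply: measurable_funM => //; exact: measurable_coord.
Qed.

Lemma integral_leb0 (f : 'cV[R]_0 -> \bar R) : measurable_fun setT f ->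
  (\int[leb 0]_v f v = f 0%R)%E.
Proof. by move=> mf; rewrite /leb /= integral_dirac// diracT mul1e. Qed.

Definition ccol n (x : R) (v : 'cV[R]_n) : 'cV[R]_n.+1 := cons_col (v, x).

Lemma integral_lebS n (f : 'cV[R]_n.+1 -> \bar R) :
  measurable_fun setT f -> (forall x, 0 <= f x)%E ->
  (\int[leb n.+1]_v f v =
   \int[leb n]_v \int[lebesgue_measure]_x f (ccol x v))%E.
Proof.
move=> mf f0.
rewrite [LHS](_ : _ = \int[pushforward (leb n \x @lebesgue_measure R)%E
  (@cons_col R n)]_v f v)%E//.
have mc := @measurable_cons_col R n.
rewrite ge0_integral_pushforward// preimage_setT.
rewrite fubini_tonelli1//; last by move=> z; exact: f0.
exact: (measurableT_comp mf mc).
Qed.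

Lemma integral_lebS_swap n (f : 'cV[R]_n.+1 -> \bar R) :
  measurable_fun setT f -> (forall x, 0 <= f x)%E ->
  (\int[leb n.+1]_v f v =
   \int[lebesgue_measure]_x \int[leb n]_v f (ccol x v))%E.
Proof.
move=> mf f0; rewrite integral_lebS//.
apply: (@fubini_tonelli _ _ _ _ _ _ _ (f \o @cons_col R n)).
  exact: (measurableT_comp mf (@measurable_cons_col R n)).
by move=> z; exact: f0.
Qed.

Lemma measurable_int_ccol n (f : 'cV[R]_n.+1 -> \bar R) :
  measurable_fun setT f -> (forall x, 0 <= f x)%E ->
  measurable_fun setT (fun v => \int[lebesgue_measure]_x f (ccol x v))%E.
Proof.
move=> mf f0.
apply: (measurable_fun_fubini_tonelli_F (f \o @cons_col R n)) => [|z].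
  exact: (measurableT_comp mf (@measurable_cons_col R n)).
exact: f0.
Qed.

Lemma measurable_int_ccol_swap n (f : 'cV[R]_n.+1 -> \bar R) :
  measurable_fun setT f -> (forall x, 0 <= f x)%E ->
  measurable_fun setT (fun x : measurableTypeR R => \int[leb n]_v f (ccol x v))%E.
Proof.
move=> mf f0.
apply: (measurable_fun_fubini_tonelli_G (m1 := leb n) (f \o @cons_col R n)) => [|z].
  exact: (measurableT_comp mf (@measurable_cons_col R n)).
exact: f0.
Qed.

Lemma measurable_ccoll n (v : 'cV[R]_n) :
  measurable_fun setT (fun x : measurableTypeR R => ccol x v).
Proof.
by apply: measurableT_comp; [exact: measurable_cons_col|exact: pair1_measurable].
Qed.

Lemma measurable_ccolr n (x : R) :
  measurable_fun setT (fun v : 'cV[R]_n => ccol x v).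
Proof.
apply: (measurableT_comp (@measurable_cons_col R n)).
exact: pair2_measurable.
Qed.

(** The shift [b] makes the block triangular cases go through by induction: for
    a lower block, the first coordinate of the argument becomes part of the
    shift in the remaining ones. *)
Definition linear_change n (A : 'M[R]_n) := forall (b : 'cV[R]_n) f,
  measurable_fun setT f -> (forall v, 0 <= f v)%E ->
  (`|\det A|%:E * \int[leb n]_v f (A *m v + b)%R = \int[leb n]_v f v)%E.

Lemma linear_changeM n (A B : 'M[R]_n) :
  linear_change A -> linear_change B -> linear_change (A *m B).
Proof.
move=> cA cB b f mf f0; rewrite -(cA b f)//.
rewrite -(cB 0 (fun v => f (A *m v + b))) => [|//|//]; last first.
  exact: (measurableT_comp mf (measurable_affine A b)).
rewrite det_mulmx normrM EFinM muleA; congr *%E.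
by apply: eq_integral => v _; rewrite addr0 mulmxA.
Qed.

Lemma ccolE n (x : R) (v : 'cV[R]_n) : ccol x v = col_mx x%:M v.
Proof. by []. Qed.

Lemma ccolP n (b : 'cV[R]_n.+1) : exists x v, b = ccol x v.
Proof.
exists ((b : 'cV_(1 + n)) (lshift n ord0) 0), (dsubmx (b : 'cV_(1 + n))).
rewrite ccolE -[LHS](@vsubmxK _ 1 n 1).
apply: (congr2 (@col_mx R 1 n 1)) => //.
by apply/matrixP => i j; rewrite !ord1 !mxE.
Qed.

Lemma block_ccol n (a : R) (r : 'rV[R]_n) (c : 'cV[R]_n) (D : 'M[R]_n) x v b1 b2 :
  (block_mx a%:M r c D : 'M[R]_(1 + n)) *m ccol x v + ccol b1 b2 =
  ccol (a * x + ((r *m v) 0 0 + b1)) (D *m v + (x *: c + b2)).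
Proof.
rewrite !ccolE (@mul_block_col _ 1 n) (@add_col_mx _ 1 n).
apply: (congr2 (@col_mx R 1 n 1)).
  by apply/matrixP => i j; rewrite !ord1 -scalar_mxM !mxE eqxx !mulr1n addrA.
by rewrite mul_mx_scalar [_ *: c + D *m v]addrC addrA.
Qed.

(** Integrating the first coordinate first, the row [r] is only a shift. *)
Lemma linear_change_ublock n (a : R) (r : 'rV[R]_n) (D : 'M[R]_n) :
  a != 0 -> linear_change D -> linear_change (block_mx a%:M r 0 D : 'M[R]_(1 + n)).
Proof.
move=> a0 cD b f mf f0; have [b1 [b2 ->]] := ccolP b.
have mA := measurable_affine (block_mx a%:M r 0 D : 'M[R]_(1 + n)) (ccol b1 b2).
rewrite (@det_ublock _ 1 n) det_scalar1 normrM EFinM integral_lebS//; last first.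
  exact: (measurableT_comp mf mA).
rewrite integral_lebS//.
rewrite -[RHS](cD b2); last 2 first.
- exact: measurable_int_ccol.
- by move=> v; apply: integral_ge0.
rewrite muleAC muleC; congr *%E.
rewrite -ge0_integralZl_EFin//; last 2 first.
- by move=> v _; apply: integral_ge0.
- apply: (measurable_int_ccol (measurableT_comp mf mA)) => v; exact: f0.
apply: eq_integral => v _.
rewrite -[RHS](integral_affine1 ((r *m v) 0 0 + b1) a0)//; last first.
  exact: (measurableT_comp mf (@measurable_ccoll _ _)).
by congr *%E; apply: eq_integral => x _; rewrite block_ccol scaler0 add0r.
Qed.

(** Integrating the first coordinate last, the column [c] is only a shift. *)
Lemma linear_change_lblock n (a : R) (c : 'cV[R]_n) (D : 'M[R]_n) :
  a != 0 -> linear_change D -> linear_change (block_mx a%:M 0 c D : 'M[R]_(1 + n)).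
Proof.
move=> a0 cD b f mf f0; have [b1 [b2 ->]] := ccolP b.
have mA := measurable_affine (block_mx a%:M 0 c D : 'M[R]_(1 + n)) (ccol b1 b2).
rewrite (@det_lblock _ 1 n) det_scalar1 normrM EFinM integral_lebS_swap//; last first.
  exact: (measurableT_comp mf mA).
rewrite integral_lebS_swap//.
rewrite -[RHS](integral_affine1 b1 a0); last 2 first.
- exact: measurable_int_ccol_swap.
- by move=> v; apply: integral_ge0.
rewrite -muleA; congr *%E.
rewrite -ge0_integralZl_EFin//; last 2 first.
- by move=> v _; apply: integral_ge0.
- apply: (measurable_int_ccol_swap (measurableT_comp mf mA)) => v; exact: f0.
apply: eq_integral => x _.
rewrite -[RHS](cD (x *: c + b2) (fun v => f (ccol (a * x + b1) v)))//; last first.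
  exact: (measurableT_comp mf (@measurable_ccolr _ _)).
congr *%E; apply: eq_integral => v _.
by rewrite block_ccol mul0mx mxE add0r.
Qed.

(** A permutation of the coordinates maps boxes to boxes of the same volume. *)
Lemma linear_change_perm n (s : 'S_n) : linear_change (perm_mx s).
Proof.
move=> b f mf f0; rewrite det_perm normrX normrN1 expr1n mul1e.
have mA := measurable_affine (perm_mx s) b.
have : (\int[pushforward_measure (leb n) mA]_v f v = \int[leb n]_v f v)%E.
  apply: eq_measure_integral => A mA' _.
  apply: (@lebesgue_col_unique _ _ (pushforward_measure (leb n) mA)) => // B mB.
  rewrite /= /pushforward.
  pose B' j : set (measurableTypeR R) :=
    (fun x : measurableTypeR R => (1 * x + b (s^-1%g j) 0 : measurableTypeR R)) @^-1` B (s^-1%g j).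
  have -> : (fun v => perm_mx s *m v + b) @^-1` box B = box B'.
    apply/seteqP; split=> v /= vB i.
      by have := vB (s^-1%g i); rewrite -row_permE !mxE permKV /B' /= mul1r.
    by have := vB (s i); rewrite -row_permE !mxE /B'/= permK mul1r.
  rewrite /leb lebesgue_col_box; last first.
    by move=> i; rewrite -[X in measurable X]setTI; exact: measurable_affine1.
  rewrite (reindex_inj (@perm_inj _ s))/=; apply: eq_bigr => i _.
  rewrite /B' permK -[RHS](lebesgue_measure_affine (b i 0) (oner_neq0 R))//.
  by rewrite normr1 mul1e.
by move=> <-; rewrite [RHS](ge0_integral_pushforward mA).
Qed.

(** Gaussian elimination: after a row exchange that brings a nonzero pivot to
    the top, the matrix is a lower times an upper block triangular matrix, whose
    smaller blocks are the identity and the Schur complement. *)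
Lemma linear_change_unit n (A : 'M[R]_n) : \det A != 0 -> linear_change A.
Proof.
elim: n => [|n ih] in A *.
  move=> _ b f mf f0; rewrite det_mx00 normr1 mul1e !integral_leb0//.
    by congr f; apply/matrixP => -[].
  exact: (measurableT_comp mf (measurable_affine A b)).
rewrite -[n.+1]/(1 + n)%N => dA.
have [k Ak0] : exists k, A k 0 != 0.
  apply/existsP; apply: contraNT dA => /existsPn A0.
  by rewrite (expand_det_col A 0) big1// => i _; rewrite (eqP (negbNE (A0 i))) mul0r.
(* Bring the pivot to the top left corner. *)
pose A1 : 'M[R]_(1 + n) := xrow 0 k A.
have AE : A = tperm_mx 0 k *m A1.
  by rewrite /A1 xrowE mulmxA -perm_mxM tperm2 perm_mx1 mul1mx.
pose a := A k 0; pose r := ursubmx A1; pose c := dlsubmx A1.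
pose D := drsubmx A1 - (a^-1 *: c) *m r.
have A1E : A1 = block_mx 1%:M 0 (a^-1 *: c) 1%:M *m block_mx a%:M r 0 D.
  rewrite mulmx_block !mul1mx !mul0mx !addr0 mul_mx_scalar scalerA.
  rewrite divff// scale1r addrC subrK -[LHS]submxK; congr block_mx.
  by apply/matrixP => i j; rewrite !ord1 !mxE lshift0 tpermL eqxx mulr1n.
have dD : \det D != 0.
  apply: contra_neq dA => dD; rewrite AE A1E !det_mulmx det_ublock dD.
  by rewrite !mulr0.
rewrite AE A1E; apply: linear_changeM; first exact: linear_change_perm.
apply: linear_changeM.
  by apply: linear_change_lblock; rewrite ?oner_neq0//; apply: ih; rewrite det1 oner_neq0.
by apply: linear_change_ublock => //; exact: ih.
Qed.

End linear_change_of_variables.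

(** * Products, Cholesky factors and Gaussian integrals *)
Section product.
Context {R : realType}.

Lemma measurable_pair_col m n :
  measurable_fun setT (fun z : 'cV[R]_m * 'cV[R]_n => col_mx z.1 z.2).
Proof.
apply: measurable_fun_col => i; rewrite -(fintype.splitK i); case: (fintype.split i) => j /=.
  under eq_fun do rewrite col_mxEu.
  exact: (measurableT_comp (measurable_coord j) measurable_fst).
under eq_fun do rewrite col_mxEd.
exact: (measurableT_comp (measurable_coord j) measurable_snd).
Qed.

Lemma integral_leb_col_mx m n (f : 'cV[R]_(m + n) -> \bar R) :
  measurable_fun setT f -> (forall v, 0 <= f v)%E ->
  (\int[leb (m + n)]_v f v =
   \int[leb m]_u \int[leb n]_z f (col_mx u z))%E.
Proof.
move=> mf f0; have mc := @measurable_pair_col m n.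
rewrite (@eq_measure_integral _ _ _ setT
    (pushforward_measure (leb m \x leb n)%E mc)); last first.
  move=> A mA _; apply/esym.
  apply: (lebesgue_col_unique (m := pushforward_measure (leb m \x leb n)%E mc)) => // B mB.
  transitivity ((leb m \x leb n)%E (box (fun i => B (lshift n i)) `*`
    box (fun i => B (rshift m i)))).
    congr (product_measure1 _ _ _); apply/seteqP; split=> -[u v] /=.
      move=> uvB; split=> i; first by have := uvB (lshift n i); rewrite col_mxEu.
      by have := uvB (rshift m i); rewrite col_mxEd.
    move=> [uB vB] i; rewrite -(fintype.splitK i); case: (fintype.split i) => j /=.
      by rewrite col_mxEu; exact: uB.
    by rewrite col_mxEd; exact: vB.
  rewrite product_measure1E; last 2 first.
  - by apply: measurable_box => i; exact: mB.
  - by apply: measurable_box => i; exact: mB.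
  rewrite /leb !lebesgue_col_box; last 2 first.
  - by move=> i; exact: mB.
  - by move=> i; exact: mB.
  by rewrite [RHS]big_split_ord.
rewrite (ge0_integral_pushforward mc)// preimage_setT fubini_tonelli1//.
  exact: (measurableT_comp mf mc).
by move=> z; exact: f0.
Qed.

Lemma integral_leb_col_mx_swap m n (f : 'cV[R]_(m + n) -> \bar R) :
  measurable_fun setT f -> (forall v, 0 <= f v)%E ->
  (\int[leb (m + n)]_v f v =
   \int[leb n]_z \int[leb m]_u f (col_mx u z))%E.
Proof.
move=> mf f0; rewrite integral_leb_col_mx//.
apply: (@fubini_tonelli _ _ _ _ _ _ _ (fun z => f (col_mx z.1 z.2))).
  exact: (measurableT_comp mf (@measurable_pair_col m n)).
by move=> z; exact: f0.
Qed.

End product.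

Section cholesky.
Context {R : realType}.

Definition posdef n (C : 'M[R]_n) := forall v, v != 0 -> 0 < quad_form C v.

(** A Cholesky factorization, by induction through the Schur complement, which
    inherits positivity: it is the minimum of the form over the first
    coordinate. *)
Lemma posdef_factor n (C : 'M[R]_n) : C^T = C -> posdef C ->
  exists2 S : 'M[R]_n, C = S^T *m S & 0 < \det S.
Proof.
elim: n => [|n ih] in C *.
  by move=> _ _; exists 1%:M; rewrite ?det1//; apply/matrixP => -[].
move: C; rewrite -[n.+1]/(1 + n)%N => C symC pC.
pose a := C 0 0; pose r := ursubmx C.
have CE : C = block_mx a%:M r r^T (drsubmx C).
  rewrite -[LHS]submxK; congr block_mx.
    by apply/matrixP => i j; rewrite !ord1 !mxE eqxx mulr1n lshift0.
  by rewrite /r trmx_ursub symC.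
have a0 : 0 < a.
  have := pC (delta_mx 0 0); rewrite /quad_form trmx_delta -rowE -colE !mxE; apply.
  by apply/eqP => /matrixP /(_ 0 0); rewrite !mxE !eqxx => /eqP; rewrite oner_eq0.
pose D := drsubmx C - a^-1 *: (r^T *m r).
have symD : D^T = D.
  by rewrite /D linearB linearZ/= trmx_mul trmxK trmx_drsub symC.
have pD : posdef D.
  move=> v v0; pose t := - (a^-1 *: (r *m v)).
  have tv0 : (col_mx t v : 'cV[R]_(1 + n)) != 0.
    apply: contra_neq v0 => /(congr1 dsubmx); rewrite col_mxKd => ->.
    by rewrite -[RHS](@col_mxKd _ 1 n 1 0) col_mx0.
  have := pC _ tv0; rewrite {1}CE /quad_form tr_col_mx mul_row_block mul_row_col.
  congr (_ < _).
  have -> : t^T *m a%:M + v^T *m r^T = 0.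
    rewrite /t linearN linearZ/= trmx_mul mulNmx -scalemxAl mul_mx_scalar scalerA.
    by rewrite mulVf ?gt_eqF// scale1r addNr.
  rewrite mul0mx add0r /t linearN linearZ/= trmx_mul mulNmx -scalemxAl.
  by rewrite /D mulmxBr -scalemxAr mulmxA addrC.
have [S DE dS] := ih _ symD pD.
exists (block_mx (Num.sqrt a)%:M ((Num.sqrt a)^-1 *: r) 0 S); last first.
  by rewrite det_ublock det_scalar1 mulr_gt0// sqrtr_gt0.
have sa0 : Num.sqrt a != 0 by rewrite gt_eqF// sqrtr_gt0.
rewrite tr_block_mx mulmx_block trmx0 !mul0mx !addr0 tr_scalar_mx.
rewrite -scalar_mxM -expr2 sqr_sqrtr ?ltW// mul_scalar_mx scalerA divff// scale1r.
rewrite linearZ/= mul_mx_scalar scalerA divff// scale1r mulmx0 ?addr0.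
rewrite -scalemxAl -scalemxAr scalerA -expr2 exprVn sqr_sqrtr ?ltW// -DE /D.
by rewrite addrC subrK.
Qed.
End cholesky.

Section gaussian.
Context {R : realType}.
Local Notation mu := (@lebesgue_measure R).

Lemma integral_gauss1 (x : R) : 0 < x ->
  (\int[mu]_t (expR (- (x * t ^+ 2)))%:E = (Num.sqrt (pi / x))%:E)%E.
Proof.
move=> x0; have sx0 : 0 < Num.sqrt x by rewrite sqrtr_gt0.
have := @integral_affine1 R (Num.sqrt x) 0 (fun t => (gauss_fun t)%:E).
rewrite integralT_gauss gtr0_norm// => /(_ _ _ _) E.
have {}E : ((Num.sqrt x)%:E * (\int[mu]_t (expR (- (x * t ^+ 2)))%:E) = (Num.sqrt pi)%:E)%E.
  rewrite -E ?gt_eqF//.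
  - congr *%E; apply: eq_integral => t _; rewrite /gauss_fun addr0 exprMn.
    by rewrite sqr_sqrtr// ltW.
  - by apply/measurable_EFinP; exact: measurable_gauss_fun.
  - by move=> t; rewrite lee_fin gauss_fun_ge0.
rewrite sqrtrM ?pi_ge0// sqrtrV ?ltW// mulrC EFinM -E muleA -EFinM.
by rewrite mulVf ?gt_eqF// mul1e.
Qed.

Lemma measurable_sqnorm n : measurable_fun setT (@sqnorm R n).
Proof.
apply: measurable_sum => i; apply: measurable_funX; exact: measurable_coord.
Qed.

Lemma quad_formE n (C : 'M[R]_n) v :
  quad_form C v = \sum_j (\sum_i v i 0 * C i j) * v j 0.
Proof.
rewrite /quad_form !mxE; apply: eq_bigr => j _; rewrite !mxE.
by congr (_ * _); apply: eq_bigr => i _; rewrite !mxE.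
Qed.

Lemma measurable_quad_form n (C : 'M[R]_n) : measurable_fun setT (quad_form C).
Proof.
rewrite (_ : quad_form C = fun v => \sum_j (\sum_i v i 0 * C i j) * v j 0); last first.
  by apply/funext => v; exact: quad_formE.
apply: measurable_sum => j; apply: measurable_funM; last exact: measurable_coord.
apply: measurable_sum => i; apply: measurable_funM => //; exact: measurable_coord.
Qed.

Lemma sqnormE n (v : 'cV[R]_n) : sqnorm v = (v^T *m v) 0 0.
Proof. by rewrite mxE; apply: eq_bigr => i _; rewrite mxE expr2. Qed.

Lemma quad_form_factor m n (S : 'M[R]_(m, n)) v :
  quad_form (S^T *m S) v = sqnorm (S *m v).
Proof. by rewrite /quad_form sqnormE trmx_mul !mulmxA. Qed.

Lemma sqnorm_ccol n (t : R) (v : 'cV[R]_n) : sqnorm (ccol t v) = t ^+ 2 + sqnorm v.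
Proof.
rewrite /sqnorm big_ord_recl /ccol cons_col0; congr (_ + _).
by apply: eq_bigr => i _; rewrite cons_colS.
Qed.

Lemma integral_gauss n (x : R) : 0 < x ->
  (\int[leb n]_v (expR (- (x * sqnorm v)))%:E =
   (Num.sqrt (pi / x) ^+ n)%:E)%E.
Proof.
move=> x0; have mf m : measurable_fun setT (fun v : 'cV[R]_m => (expR (- (x * sqnorm v)))%:E).
  apply/measurable_EFinP; apply: measurableT_comp => //; apply: measurableT_comp => //.
  by apply: measurable_funM => //; exact: measurable_sqnorm.
elim: n => [|n ih].
  by rewrite integral_leb0 ?expr0// /sqnorm big_ord0 mulr0 oppr0 expR0.
rewrite integral_lebS//.
under eq_integral => v _.
  under eq_integral => t _ do rewrite sqnorm_ccol mulrDr opprD expRD mulrC EFinM.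
  rewrite ge0_integralZl_EFin//; last first.
    apply/measurable_EFinP; apply: measurableT_comp => //; apply: measurableT_comp => //.
    by apply: measurable_funM => //; apply: measurable_funX.
  rewrite integral_gauss1// muleC.
  over.
rewrite ge0_integralZl_EFin//; last exact: mf.
by rewrite ih exprS EFinM.
Qed.

(** The change of variables given by a Cholesky factor of [C] reduces this to
    [C = 1], where the integral is a power of the one-dimensional one. *)
Lemma integral_gauss_quad n (C : 'M[R]_n) (m : 'cV[R]_n) (x : R) : 0 < x ->
  C^T = C -> posdef C ->
  (\int[leb n]_v (expR (- (x * quad_form C (v - m))))%:E =
   (Num.sqrt (pi / x) ^+ n / Num.sqrt (\det C))%:E)%E.
Proof.
move=> x0 symC pC; have [S CE dS] := posdef_factor symC pC.
have := @linear_change_unit R n S _ (- (S *m m)) (fun v => (expR (- (x * sqnorm v)))%:E).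
rewrite integral_gauss// gt_eqF// gtr0_norm// => /(_ isT _ _) E.
have -> : Num.sqrt (\det C) = \det S.
  by rewrite CE det_mulmx det_tr -expr2 sqrtr_sqr gtr0_norm.
rewrite mulrC EFinM -E; last 2 first.
- apply/measurable_EFinP; apply: measurableT_comp => //; apply: measurableT_comp => //.
  by apply: measurable_funM => //; exact: measurable_sqnorm.
- by move=> v; rewrite lee_fin expR_ge0.
rewrite muleA -EFinM mulVf ?gt_eqF// mul1e; apply: eq_integral => v _.
by rewrite CE quad_form_factor mulmxBr.
Qed.

End gaussian.

(** * The Gamma integral and the total mass of the t density *)
Section gamma.
Context {R : realType}.
Local Notation mu := (@lebesgue_measure R).

(** The integrand of the Gamma integral with rate [y], extended by zero. *)
Definition gamma_ker (a y x : R) : R :=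
  \1_(`]0, +oo[) x * (x `^ (a - 1) * expR (- (x * y))).

Definition egamma (a : R) : \bar R := (\int[mu]_x (gamma_ker a 1 x)%:E)%E.

Lemma gamma_ker_pos a y x : 0 < x ->
  gamma_ker a y x = x `^ (a - 1) * expR (- (x * y)).
Proof.
by move=> x0; rewrite /gamma_ker indicE mem_set ?mul1r//= in_itv/= x0.
Qed.

Lemma gamma_ker_neg a y x : ~~ (0 < x) -> gamma_ker a y x = 0.
Proof.
move=> x0; rewrite /gamma_ker indicE memNset ?mul0r//=.
by rewrite in_itv/= andbT; exact/negP.
Qed.

Lemma gamma_ker_ge0 a y x : 0 <= gamma_ker a y x.
Proof.
have [x0|x0] := boolP (0 < x); last by rewrite gamma_ker_neg.
by rewrite gamma_ker_pos// mulr_ge0 ?powR_ge0 ?expR_ge0.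
Qed.

Lemma measurable_gamma_ker a y : measurable_fun setT (gamma_ker a y).
Proof.
apply: measurable_funM; first exact: measurable_indic.
apply: measurable_funM; first exact: measurable_powR.
apply: measurableT_comp => //; apply: measurableT_comp => //.
exact: measurable_funM.
Qed.

Lemma gamma_funE (a : R) : gamma_fun a = fine (egamma a).
Proof.
rewrite /gamma_fun /Rintegral integral_mkcond /egamma; congr fine.
apply: eq_integral => x _; rewrite patchE; case: ifPn => [|].
  rewrite inE/= in_itv/= andbT => x0; by rewrite gamma_ker_pos// mulr1.
by rewrite notin_setE/= in_itv/= andbT => x0; rewrite gamma_ker_neg//; exact/negP.
Qed.

Lemma integral_gamma_ker (a y : R) : 0 < y ->
  (\int[mu]_x (gamma_ker a y x)%:E = (y `^ (- a))%:E * egamma a)%E.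
Proof.
move=> y0; rewrite /egamma.
have := @integral_affine1 R y 0 (fun x => (gamma_ker a 1 x)%:E).
rewrite gt_eqF// gtr0_norm// => /(_ isT _ _) <-; last 2 first.
- by apply/measurable_EFinP; exact: measurable_gamma_ker.
- by move=> x; rewrite lee_fin gamma_ker_ge0.
have -> : (\int[mu]_x (gamma_ker a 1 (y * x + 0)%R)%:E =
    (y `^ (a - 1))%:E * \int[mu]_x (gamma_ker a y x)%:E)%E.
  rewrite -ge0_integralZl_EFin//; last 3 first.
  - by move=> x _; rewrite lee_fin gamma_ker_ge0.
  - by apply/measurable_EFinP; exact: measurable_gamma_ker.
  - exact: powR_ge0.
  apply: eq_integral => x _; rewrite -EFinM addr0; congr EFin.
  have [x0|x0] := boolP (0 < x); last first.
    by rewrite !gamma_ker_neg ?mulr0// pmulr_rgt0.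
  rewrite !gamma_ker_pos ?pmulr_rgt0// powRM ?ltW// mulrA mulr1.
  by rewrite [x * y]mulrC.
rewrite !muleA -!EFinM -[X in _ * X * _]powRr1 ?ltW// -!powRD; last 2 first.
- by rewrite (gt_eqF y0) implybT.
- by rewrite (gt_eqF y0) implybT.
by rewrite (_ : - a + 1 + (a - 1) = 0) ?powRr0 ?mul1e//; ring.
Qed.

Lemma egamma_ge0 a : (0 <= egamma a)%E.
Proof. by apply: integral_ge0 => x _; rewrite lee_fin gamma_ker_ge0. Qed.

Lemma egamma_gt0 a : 0 <= a -> (0 < egamma a)%E.
Proof.
move=> a0; pose c : R := 2^-1 * expR (- 2).
have c0 : 0 < c by rewrite mulr_gt0 ?expR_gt0 ?invr_gt0.
(* On [1, 2] the integrand is at least [2^-1 * expR (- 2)]. *)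
apply: (@lt_le_trans _ _ (\int[mu]_(x in `[1%R, 2%R]) (cst c%:E) x)%E).
  rewrite integral_cst//= lebesgue_measure_itv/= lte_fin ltr1n.
  by rewrite -EFinD -EFinM lte_fin mulr_gt0// subr_gt0 ltr1n.
rewrite integral_mkcond; apply: ge0_le_integral => //.
- by move=> x _; rewrite patchE; case: ifP => // _; rewrite lee_fin ltW.
- apply/(measurable_restrictT _ _).1 => //.
- by apply/measurable_EFinP; exact: measurable_gamma_ker.
move=> x _; rewrite patchE; case: ifPn => [|_]; last by rewrite lee_fin gamma_ker_ge0.
rewrite inE/= in_itv/= => /andP[x1 x2]; have x0 : 0 < x by exact: lt_le_trans x1.
rewrite lee_fin gamma_ker_pos// mulr1 ler_pM ?expR_ge0//; last by rewrite ler_expR lerN2.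
apply: (@le_trans _ _ (x `^ (-1))); last first.
  by rewrite ler_powR// lerDr.
by rewrite powRN (powRr1 (ltW x0)) lef_pV2 ?posrE.
Qed.

Lemma sqrt_exprn_powR (x : R) p : 0 < x -> Num.sqrt x ^+ p = x `^ (p%:R / 2).
Proof.
move=> x0; rewrite -powR_mulrn ?sqrtr_ge0// -powR12_sqrt ?ltW//.
by rewrite -powRrM mulrC.
Qed.

Lemma measurable_quad_form_sub p (C : 'M[R]_p) (m : 'cV[R]_p) :
  measurable_fun setT (fun t : 'cV[R]_p => quad_form C (t - m)).
Proof.
have := measurableT_comp (measurable_quad_form C) (measurable_affine 1%:M (- m)).
by congr measurable_fun; apply/funext => t /=; rewrite mul1mx.
Qed.

Lemma measurable_mvt_kernel (k a : R) p (C : 'M[R]_p) (m : 'cV[R]_p) :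
  measurable_fun setT (fun t : 'cV[R]_p => (1 + quad_form C (t - m) / k) `^ a).
Proof.
apply: (measurableT_comp (measurable_powR _)).
apply: measurable_funD => //; apply: measurable_funM => //.
exact: measurable_quad_form_sub.
Qed.

(** The Gamma integral with rate [1 + q / k], where [q] is the quadratic form in
    [t - m], turns the power into a mixture of Gaussian functions of [t].
    Integrating these first leaves a Gamma integral whose exponent has dropped
    by [p / 2]. *)
Lemma integral_mvt_kernel k p (C : 'M[R]_p) (m : 'cV[R]_p) : (0 < k)%N ->
  C^T = C -> posdef C ->
  (egamma ((k + p)%:R / 2) * \int[leb p]_t
     ((1 + quad_form C (t - m) / k%:R) `^ (- ((k + p)%:R / 2)))%:E =
   (Num.sqrt (k%:R * pi) ^+ p / Num.sqrt (\det C))%:E * egamma (k%:R / 2))%E.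
Proof.
move=> k0 symC pC; set a := (k + p)%:R / 2.
have kR0 : 0 < k%:R :> R by rewrite ltr0n.
have mq := measurable_quad_form_sub C m.
have q0 t : 0 <= quad_form C t.
  have [->|t0] := eqVneq t 0; last by rewrite ltW// pC.
  by rewrite /quad_form mulmx0 mxE.
have q1 t : 0 < 1 + quad_form C t / k%:R.
  by rewrite ltr_wpDr// divr_ge0// ler0n.
rewrite -ge0_integralZl//; last 3 first.
- by apply/measurable_EFinP; exact: measurable_mvt_kernel.
- by move=> t _; rewrite lee_fin powR_ge0.
- exact: egamma_ge0.
under eq_integral => t _ do rewrite muleC -integral_gamma_ker//.
rewrite (fubini_tonelli (fun z : 'cV[R]_p * measurableTypeR R =>
  (gamma_ker a (1 + quad_form C (z.1 - m) / k%:R) z.2)%:E)); last 2 first.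
- apply/measurable_EFinP; apply: measurable_funM.
    by apply: measurableT_comp measurable_snd; exact: measurable_indic.
  apply: measurable_funM.
    exact: (measurableT_comp (measurable_powR _) measurable_snd).
  apply: measurableT_comp => //; apply: measurableT_comp => //.
  apply: measurable_funM; first exact: measurable_snd.
  apply: measurable_funD => //; apply: measurable_funM => //.
  exact: (measurableT_comp mq measurable_fst).
- by move=> z; rewrite lee_fin gamma_ker_ge0.
rewrite -ge0_integralZl//; last 2 first.
- by apply/measurable_EFinP; exact: measurable_gamma_ker.
- by move=> t _; rewrite lee_fin gamma_ker_ge0.
apply: eq_integral => x _ /=.
have [x0|x0] := boolP (0 < x); last first.
  under eq_integral do rewrite gamma_ker_neg//.
  by rewrite integral0 gamma_ker_neg// mule0.
have xk0 : 0 < x / k%:R by rewrite divr_gt0.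
transitivity (\int[leb p]_t ((gamma_ker a 1 x)%:E *
    (expR (- ((x / k%:R) * quad_form C (t - m))))%:E))%E.
  apply: eq_integral => t _; rewrite !gamma_ker_pos// -EFinM.
  congr EFin; rewrite -[RHS]mulrA -expRD; congr (_ * expR _); rewrite /=; field.
  by rewrite gt_eqF.
rewrite ge0_integralZl_EFin ?gamma_ker_ge0//; last first.
  apply/measurable_EFinP; apply: measurableT_comp => //; apply: measurableT_comp => //.
  exact: measurable_funM.
rewrite integral_gauss_quad// -!EFinM; congr EFin.
have -> : Num.sqrt (pi / (x / k%:R)) = Num.sqrt (k%:R * pi) / Num.sqrt x.
  rewrite -sqrtrV ?ltW// -sqrtrM ?mulr_ge0 ?pi_ge0 ?ler0n//; congr Num.sqrt.
  by field; rewrite !gt_eqF.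
rewrite expr_div_n (sqrt_exprn_powR p x0) -powRN !gamma_ker_pos//.
rewrite (_ : k%:R / 2 - 1 = a - 1 + - (p%:R / 2)); last by rewrite /a natrD; ring.
rewrite [in RHS]powRD; last by rewrite (gt_eqF x0) implybT.
by rewrite !mulr1; ring.
Qed.

Lemma integral_oneDsqr : (\int[mu]_x ((1 + x ^+ 2)^-1)%:E = pi%:E)%E.
Proof.
rewrite (@ge0_symfun_integralT R (fun x => (1 + x ^+ 2)^-1)).
- rewrite -set_itvcy integral0y_oneDsqr -EFinM; congr EFin.
  by rewrite mulrCA divff ?mulr1.
- by move=> x; rewrite invr_ge0 addr_ge0// sqr_ge0.
- exact: continuous_oneDsqrV.
- by move=> x /=; rewrite sqrrN.
Qed.

Lemma quad_form1 n (v : 'cV[R]_n) : quad_form 1%:M v = sqnorm v.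
Proof. by rewrite /quad_form mulmx1 sqnormE. Qed.

Lemma sqnorm_ge0 n (v : 'cV[R]_n) : 0 <= sqnorm v.
Proof. by apply: sumr_ge0 => i _; exact: sqr_ge0. Qed.

Lemma sqnorm_gt0 n (v : 'cV[R]_n) : v != 0 -> 0 < sqnorm v.
Proof.
move=> v0; rewrite lt_neqAle sqnorm_ge0 andbT eq_sym.
apply: contra_neq v0 => /psumr_eq0P v0; apply/colP => i; rewrite mxE.
by apply/eqP; rewrite -sqrf_eq0 v0// => j _; exact: sqr_ge0.
Qed.

Lemma posdef1 n : posdef (1%:M : 'M[R]_n).
Proof. by move=> v v0; rewrite quad_form1 sqnorm_gt0. Qed.

(** The first of the two base cases of an induction by steps of one. *)
Lemma egamma1_fin : (egamma 1 < +oo)%E.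
Proof.
apply: (@le_lt_trans _ _ (\int[mu]_x (exponential_pdf 1 x)%:E)%E); last first.
  by rewrite integral_exponential_pdf// ltry.
apply: ge0_le_integral => //.
- by move=> x _; rewrite lee_fin gamma_ker_ge0.
- by apply/measurable_EFinP; exact: measurable_gamma_ker.
- by apply/measurable_EFinP; exact: measurable_exponential_pdf.
move=> x _; rewrite lee_fin; have [x0|x0] := boolP (0 < x); last first.
  by rewrite gamma_ker_neg// exponential_pdf_ge0.
rewrite gamma_ker_pos// exponential_pdfE; last exact: ltW.
by rewrite subrr powRr0 mulr1 mulN1r.
Qed.

(** For [k = p = 1] the kernel is [(1 + x^2)^-1], with integral [pi], and
    [integral_mvt_kernel] expresses [egamma (1 / 2)] through [egamma 1]. *)
Lemma egamma_half_fin : (egamma (1%:R / 2) < +oo)%E.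
Proof.
have := @integral_mvt_kernel 1 1 1%:M 0 isT (trmx1 _ _) (@posdef1 1).
pose f (t : 'cV[R]_1) : \bar R :=
  ((1 + quad_form 1%:M (t - 0) / 1) `^ (- ((1 + 1)%:R / 2)))%:E.
have -> : (\int[leb 1]_t f t = pi%:E)%E.
  have f0 t : (0 <= f t)%E by rewrite lee_fin powR_ge0.
  have mf : measurable_fun setT f.
    by apply/measurable_EFinP; exact: measurable_mvt_kernel.
  rewrite -integral_oneDsqr integral_lebS// integral_leb0; last first.
    exact: (measurable_int_ccol mf f0).
  apply: eq_integral => x _.
  rewrite /f divff// powRN powRr1 subr0 quad_form1 divr1.
    by rewrite sqnorm_ccol /sqnorm big_ord0 addr0.
  by rewrite addr_ge0// sqnorm_ge0.
rewrite divff// det1 sqrtr1 divr1 expr1 mul1r => E.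
rewrite ltNge leye_eq; apply/negP => /eqP E12.
move: E; rewrite E12 gt0_muley ?lte_fin ?sqrtr_gt0 ?pi_gt0//.
apply/eqP; rewrite lt_eqF// lte_mul_pinfty ?egamma_ge0 ?ltry//.
by rewrite ge0_fin_numE ?egamma_ge0 ?egamma1_fin.
Qed.

(** Splitting [expR (- x)] into two halves and bounding [x * expR (- x / 2)] by
    [2] compares the integrand at [a + 1] with the rescaled integrand at [a]. *)
Lemma egamma_succ_fin a : (egamma a < +oo)%E -> (egamma (a + 1) < +oo)%E.
Proof.
move=> afin.
apply: (@le_lt_trans _ _ (\int[mu]_x (2%:E * (gamma_ker a 2^-1 x)%:E))%E).
  apply: ge0_le_integral => //.
  - by move=> x _; rewrite lee_fin gamma_ker_ge0.
  - by apply/measurable_EFinP; exact: measurable_gamma_ker.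
  - apply: measurable_funeM; apply/measurable_EFinP.
    exact: measurable_gamma_ker.
  move=> x _; rewrite -EFinM lee_fin.
  have [x0|x0] := boolP (0 < x); last by rewrite !gamma_ker_neg// mulr0.
  rewrite !gamma_ker_pos// mulr1 addrK.
  have -> : x `^ a = x `^ (a - 1) * x.
    rewrite -[X in _ = _ * X](powRr1 (ltW x0)) -powRD ?subrK//.
    by rewrite (gt_eqF x0) implybT.
  rewrite mulrCA -mulrA; apply: ler_wpM2l; first exact: powR_ge0.
  rewrite [X in - X](splitr x) opprD expRD.
  have := expR_ge1Dx (x / 2).
  rewrite mulrA => e1; apply: ler_wpM2r; first exact: expR_ge0.
  rewrite expRN ler_pdivrMr ?expR_gt0//.
  by move: e1; lra.
rewrite ge0_integralZl_EFin//; last 2 first.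
- by move=> x _; rewrite lee_fin gamma_ker_ge0.
- by apply/measurable_EFinP; exact: measurable_gamma_ker.
rewrite integral_gamma_ker// muleA -EFinM; apply: lte_mul_pinfty => //.
Qed.

Lemma egamma_fin k : (0 < k)%N -> (egamma (k%:R / 2) < +oo)%E.
Proof.
elim/ltn_ind: k => -[|[|[|k]]]// ih _; first exact: egamma_half_fin.
  by rewrite divff//; exact: egamma1_fin.
rewrite -[k.+3]addn2 natrD mulrDl divff//; apply: egamma_succ_fin.
by apply: ih => //; rewrite !ltnS leqnSn.
Qed.

Lemma det_posdef_gt0 n (C : 'M[R]_n) : C^T = C -> posdef C -> 0 < \det C.
Proof.
move=> symC pC; have [S -> dS] := posdef_factor symC pC.
by rewrite det_mulmx det_tr mulr_gt0.
Qed.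

(** Finiteness and positivity of the Gamma integrals are what allows to divide
    in [integral_mvt_kernel]. *)
Lemma integral_mvt_pdf k p (C : 'M[R]_p) (m : 'cV[R]_p) : (0 < k)%N ->
  C^T = C -> posdef C ->
  (\int[leb p]_t (mvt_pdf k m (invmx C) t)%:E = 1)%E.
Proof.
move=> k0 symC pC; have dC := det_posdef_gt0 symC pC.
have kR0 : 0 < k%:R :> R by rewrite ltr0n.
have := integral_mvt_kernel m k0 symC pC.
rewrite /mvt_pdf invmxK; under [in X in _ -> X]eq_integral do rewrite EFinM.
set g1 := gamma_fun ((k + p)%:R / 2); set g2 := gamma_fun (k%:R / 2).
have gE j : (0 < j)%N -> egamma (j%:R / 2) = (gamma_fun (j%:R / 2))%:E.
  by move=> j0; rewrite gamma_funE fineK// ge0_fin_numE ?egamma_ge0 ?egamma_fin.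
have g0 j : (0 < j)%N -> 0 < gamma_fun (j%:R / 2) :> R.
  by move=> j0; rewrite -lte_fin -gE// egamma_gt0// divr_ge0.
have mf : measurable_fun setT (fun t : 'cV[R]_p =>
    ((1 + quad_form C (t - m) / k%:R) `^ (- ((k + p)%:R / 2)))%:E).
  by apply/measurable_EFinP; exact: measurable_mvt_kernel.
rewrite ge0_integralZl_EFin//; last 2 first.
- by move=> t _; rewrite lee_fin powR_ge0.
- rewrite divr_ge0 ?mulr_ge0 ?sqrtr_ge0 ?powR_ge0 ?ltW ?g0 ?addn_gt0 ?k0//.
rewrite !gE ?addn_gt0 ?k0// -/g1 -/g2 det_inv => E.
rewrite mulrC EFinM -muleA [X in (_ * X)%E]E -!EFinM; congr EFin.
rewrite sqrtrV ?ltW// sqrt_exprn_powR ?mulr_gt0 ?pi_gt0//.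
have g20 : g2 != 0 by rewrite gt_eqF// g0.
have dC0 : Num.sqrt (\det C) != 0 by rewrite gt_eqF// sqrtr_gt0.
have pk0 : (k%:R * pi) `^ (p%:R / 2) != 0 :> R.
  by rewrite gt_eqF// powR_gt0// mulr_gt0 ?pi_gt0.
by field; rewrite g20 dC0 pk0.
Qed.

End gamma.

(** * Minimizers *)
Section argmin.
Context {R : realType}.

Lemma argmin_eq p (f : 'cV[R]_p -> R) b :
  (forall b', b' != b -> f b < f b') -> argmin f = b.
Proof.
move=> fb; apply: xget_unique => // b' /= fb'.
apply/eqP/negP => /negP b'b.
have : f b' < f b by apply: fb'; rewrite eq_sym.
by rewrite ltNge ltW// fb.
Qed.

Lemma quad_form_sub p (C : 'M[R]_p) (u v : 'cV[R]_p) : C^T = C ->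
  quad_form C (u - v) =
  quad_form C u - 2 * (u^T *m (C *m v)) 0 0 + quad_form C v.
Proof.
move=> symC.
have vu : (v^T *m C *m u) 0 0 = (u^T *m (C *m v)) 0 0.
  have <- : ((v^T *m C *m u)^T) 0 0 = (v^T *m C *m u) 0 0 by rewrite mxE.
  by rewrite !trmx_mul trmxK symC mulmxA.
have -> : quad_form C (u - v) =
    quad_form C u - (v^T *m C *m u) 0 0 - ((u^T *m (C *m v)) 0 0 - quad_form C v).
  rewrite /quad_form [(u - v)^T]linearB/= mulmxBr !mulmxBl [u^T *m (C *m v)]mulmxA.
  by rewrite !mxE.
by rewrite vu; ring.
Qed.

(** Completing the square: the objective exceeds its value at [invmx C *m v] by
    the form at the difference. *)
Lemma argmin_quad p (C : 'M[R]_p) (v : 'cV[R]_p) (c : R) :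
  C^T = C -> posdef C ->
  argmin (fun u => quad_form C u - 2 * (u^T *m v) 0 0 + c) = invmx C *m v.
Proof.
move=> symC pC; have Cu : C \in unitmx.
  by rewrite unitmxE unitfE gt_eqF// det_posdef_gt0.
apply: argmin_eq => u uv; rewrite -subr_gt0.
have := pC (u - invmx C *m v); rewrite subr_eq0 => /(_ uv).
rewrite quad_form_sub// mulKVmx//; set q := quad_form C (invmx C *m v).
have -> : ((invmx C *m v)^T *m v) 0 0 = q.
  by rewrite /q /quad_form -mulmxA mulKVmx.
set q' := quad_form C u; set w := (u^T *m v) 0 0.
by move=> qq; rewrite -/q'; lra.
Qed.

(** If [b < 0], a small enough [s] gives a negative value; the proof takes
    [s = - b / (|a| + 1 - b)]. *)
Lemma affine_ge0_at0 (a b : R) : (forall s, 0 < s <= 1 -> 0 <= s * a + b) -> 0 <= b.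
Proof.
move=> ab; rewrite leNgt; apply/negP => b0.
have d0 : 0 < `|a| + 1 - b by have := normr_ge0 a; lra.
have := ab (- b / (`|a| + 1 - b)).
rewrite divr_gt0 ?oppr_gt0//= ler_pdivrMr// mul1r.
rewrite lerDr addr_ge0// => /(_ isT); apply/negP; rewrite -ltNge.
have : - b / (`|a| + 1 - b) * a <= - b / (`|a| + 1 - b) * `|a|.
  by rewrite ler_wpM2l ?ler_norm// divr_ge0 ?oppr_ge0 ?ltW.
suff : - b / (`|a| + 1 - b) * `|a| + b < 0 by lra.
rewrite mulrAC -ltrBrDr sub0r ltr_pdivrMr//.
by rewrite ltr_pM2l ?oppr_gt0//; lra.
Qed.

(** One coordinate of the Lasso objective around a minimizer [x]. Small steps
    [t] of either sign give [|r| <= l], and the steps [- s x], which shrink [x]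
    and for which the penalty is linear in [s], give [r x >= l |x|]. *)
Lemma stationary_abs_penalty (g r l x : R) : 0 <= l ->
  (forall t, 0 <= t ^+ 2 * g - 2 * (t * r) + 2 * (l * (`|x + t| - `|x|))) ->
  `|r| <= l /\ r * x = l * `|x|.
Proof.
move=> l0 H.
have rl : r <= l.
  suff : 0 <= 2 * (l - r) by lra.
  apply: (@affine_ge0_at0 g) => s /andP[s0 s1].
  have := H s; have : `|x + s| - `|x| <= s.
    by rewrite lerBlDl; apply: le_trans (ler_normD _ _) _; rewrite (gtr0_norm s0).
  move=> xs Hs.
  have : l * (`|x + s| - `|x|) <= l * s by exact: ler_wpM2l.
  move=> ls; have {}Hs : 0 <= s * (s * g + 2 * (l - r)) by lra.
  by rewrite -(pmulr_rge0 _ s0).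
have rNl : - r <= l.
  suff : 0 <= 2 * (l + r) by lra.
  apply: (@affine_ge0_at0 g) => s /andP[s0 s1].
  have := H (- s); have : `|x - s| - `|x| <= s.
    by rewrite lerBlDl; apply: le_trans (ler_normB _ _) _; rewrite (gtr0_norm s0).
  move=> xs Hs.
  have : l * (`|x - s| - `|x|) <= l * s by exact: ler_wpM2l.
  move=> ls; have {}Hs : 0 <= s * (s * g + 2 * (l + r)) by lra.
  by rewrite -(pmulr_rge0 _ s0).
have rl' : `|r| <= l by rewrite ler_norml rl lerNl rNl.
split => //; apply/eqP; rewrite eq_le; apply/andP; split.
  by apply: le_trans (ler_norm _) _; rewrite normrM ler_wpM2r.
suff : 0 <= 2 * (r * x - l * `|x|) by lra.
apply: (@affine_ge0_at0 (x ^+ 2 * g)) => s /andP[s0 s1].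
have := H (- (s * x)).
have -> : `|x - s * x| = (1 - s) * `|x|.
  by rewrite -{1}[x]mul1r -mulrBl normrM ger0_norm// subr_ge0.
move=> Hs; have {}Hs : 0 <= s * (s * (x ^+ 2 * g) + 2 * (r * x - l * `|x|)) by lra.
by rewrite -(pmulr_rge0 _ s0).
Qed.

End argmin.

(** * Stationarity of the Lasso *)
Section regression.
Context {R : realType} (n p : nat) (X : 'M[R]_(n, p)) (rankX : \rank X = p).
Local Notation G := (X^T *m X).

Lemma dotE m (u v : 'cV[R]_m) : (u^T *m v) 0 0 = \sum_j u j 0 * v j 0.
Proof. by rewrite mxE; apply: eq_bigr => j _; rewrite mxE. Qed.

Lemma pinvX : pinvmx X *m X = 1%:M.
Proof. by apply: mulVpmx; rewrite /row_full rankX. Qed.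

Lemma mulX_eq0 (v : 'cV[R]_p) : X *m v = 0 -> v = 0.
Proof. by move=> Xv; rewrite -[v]mul1mx -pinvX -mulmxA Xv mulmx0. Qed.

Lemma gram_sym : G^T = G.
Proof. by rewrite trmx_mul trmxK. Qed.

Lemma gram_posdef : posdef G.
Proof.
move=> v v0; rewrite quad_form_factor sqnorm_gt0//.
by apply: contra_neq v0; exact: mulX_eq0.
Qed.

Lemma gram_unit : G \in unitmx.
Proof.
rewrite unitmxE unitfE gt_eqF// det_posdef_gt0//; first exact: gram_sym.
exact: gram_posdef.
Qed.

Lemma gram_mx_sym : (gram_mx X)^T = gram_mx X.
Proof. by rewrite /gram_mx linearZ/= gram_sym. Qed.

Lemma gram_mx_posdef : (0 < n)%N -> posdef (gram_mx X).
Proof.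
move=> n0 v v0; rewrite /gram_mx /quad_form -scalemxAr -scalemxAl mxE.
by rewrite mulr_gt0 ?invr_gt0 ?ltr0n//; exact: gram_posdef.
Qed.

Lemma sqnorm_sub m (u v : 'cV[R]_m) :
  sqnorm (u - v) = sqnorm u - 2 * (\sum_j u j 0 * v j 0) + sqnorm v.
Proof.
by rewrite -!quad_form1 quad_form_sub ?trmx1// mul1mx dotE.
Qed.

Lemma sqnorm_residD (y : 'cV[R]_n) (b u : 'cV[R]_p) :
  sqnorm (y - X *m (b + u)) = sqnorm (y - X *m b)
    - 2 * (\sum_j (X^T *m y - G *m b) j 0 * u j 0) + sqnorm (X *m u).
Proof.
rewrite mulmxDr opprD addrA sqnorm_sub; congr (_ - 2 * _ + _).
have E : (y - X *m b)^T *m (X *m u) = (X^T *m y - G *m b)^T *m u.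
  by rewrite -mulmxA -mulmxBr trmx_mul trmxK mulmxA.
by rewrite -dotE [in LHS]E dotE.
Qed.

(** The least-squares objective is a quadratic form up to the constant
    [sqnorm y]. *)
Lemma ls_estimatorE y : ls_estimator X y = invmx G *m (X^T *m y).
Proof.
rewrite -(@argmin_quad _ _ _ _ (sqnorm y))//; [|exact: gram_sym|exact: gram_posdef].
congr argmin; apply/funext => b.
have := sqnorm_residD y 0 b; rewrite add0r mulmx0 !subr0 => ->.
rewrite quad_form_factor dotE.
have -> : \sum_j (X^T *m y - G *m 0) j 0 * b j 0 =
    \sum_j b j 0 * (X^T *m y) j 0.
  by rewrite mulmx0 subr0; apply: eq_bigr => j _; rewrite mulrC.
by ring.
Qed.

Lemma sigma_hatE y : sigma_hat X y =
  Num.sqrt (sqnorm (y - X *m (invmx G *m (X^T *m y))) / (n - p)%:R).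
Proof. by rewrite /sigma_hat ls_estimatorE. Qed.

(** Residuals are orthogonal to the column space of [X], so that the scale
    estimate does not see the parameter. *)
Lemma sigma_hat_shift (b : 'cV[R]_p) (e : 'cV[R]_n) :
  sigma_hat X (X *m b + e) = sigma_hat X e.
Proof.
rewrite !sigma_hatE; congr (Num.sqrt (sqnorm _ / _)).
rewrite !mulmxDr [X^T *m (X *m b)]mulmxA mulKmx ?gram_unit//.
by rewrite opprD addrACA subrr add0r.
Qed.

Lemma sigma_hat_ge0 y : 0 <= sigma_hat X y.
Proof. exact: sqrtr_ge0. Qed.

(** The correlation [v - G b] of the residual with the columns is a subgradient of
    the penalty at [b]; [v] stands for [X^T y], the only function of the data on
    which the estimator depends. *)
Definition lasso_kkt (lam v b : 'cV[R]_p) := forall j,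
  `|(v - G *m b) j 0| <= lam j 0 /\
  (v - G *m b) j 0 * b j 0 = lam j 0 * `|b j 0|.

(** The increment of the objective is a positive definite form plus terms
    [l |b'| - r b'] that are nonnegative because [|r| <= l]. *)
Lemma lasso_kkt_eq (lam : 'cV[R]_p) (y : 'cV[R]_n) (b : 'cV[R]_p) :
  lasso_kkt lam (X^T *m y) b -> lasso X lam y = b.
Proof.
move=> kkt; apply: argmin_eq => b' bb'.
have [u u0 ->] : exists2 u, u != 0 & b' = b + u.
  by exists (b' - b); rewrite ?subr_eq0// addrC subrK.
rewrite sqnorm_residD.
have Xb : 0 < sqnorm (X *m u) by rewrite -quad_form_factor gram_posdef.
set r := X^T *m y - G *m b.
suff : 0 <= \sum_j (lam j 0 * `|(b + u) j 0| - lam j 0 * `|b j 0| - r j 0 * u j 0).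
  by rewrite !sumrB; set s1 := \sum__ _; set s2 := \sum__ _; set s3 := \sum__ _; lra.
apply: sumr_ge0 => j _; have [rl rb] := kkt j; rewrite -/r in rb rl.
rewrite -rb [(b + u) j 0]mxE -addrA -opprD -mulrDr subr_ge0.
by rewrite (le_trans (ler_norm _))// normrM ler_wpM2r.
Qed.

Lemma minimizer_lasso_kkt (lam : 'cV[R]_p) (y : 'cV[R]_n) (b : 'cV[R]_p) :
  (forall j, 0 <= lam j 0) ->
  (forall b', sqnorm (y - X *m b) + 2 * (\sum_(j < p) lam j 0 * `|b j 0|) <=
    sqnorm (y - X *m b') + 2 * \sum_(j < p) lam j 0 * `|b' j 0|) ->
  lasso_kkt lam (X^T *m y) b.
Proof.
move=> l0 fb j.
apply: (@stationary_abs_penalty _ (sqnorm (X *m delta_mx j 0))) => // t.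
have uj i : (t *: delta_mx j 0 : 'cV[R]_p) i 0 = t * (i == j)%:R.
  by rewrite !mxE eqxx andbT.
have b'j i : (b + t *: delta_mx j 0) i 0 = b i 0 + t * (i == j)%:R.
  by rewrite [LHS]mxE uj.
have := fb (b + t *: delta_mx j 0); rewrite sqnorm_residD -scalemxAr.
have -> : sqnorm (t *: (X *m delta_mx j 0)) = t ^+ 2 * sqnorm (X *m delta_mx j 0).
  by rewrite /sqnorm mulr_sumr; apply: eq_bigr => i _; rewrite mxE exprMn.
set r := X^T *m y - G *m b.
have -> : \sum_i r i 0 * (t *: delta_mx j 0 : 'cV[R]_p) i 0 = t * r j 0.
  rewrite (bigD1 j)//= big1 ?addr0; last first.
    by move=> i ij; rewrite uj (negbTE ij) !mulr0.
  by rewrite uj eqxx mulr1 mulrC.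
rewrite (bigD1 j)//= [in X in _ <= X](bigD1 j)//= b'j eqxx mulr1.
have -> : \sum_(i < p | i != j) lam i 0 * `|(b + t *: delta_mx j 0) i 0| =
    \sum_(i < p | i != j) lam i 0 * `|b i 0|.
  by apply: eq_bigr => i ij; rewrite b'j (negbTE ij) mulr0 addr0.
by set S := \sum_(_ | _) _; lra.
Qed.

End regression.

(** * Existence and measurability of the Lasso *)
Section lipschitz_measurable.
Context {R : realType}.

(** Lipschitz functions are continuous and Borel sets are generated by open
    sets. *)
Lemma lipschitz_measurable m (g : 'cV[R]_m -> R) (K : R) :
  (forall z z', `|g z - g z'| <= K * \sum_i `|z i 0 - z' i 0|) ->
  measurable_fun setT g.
Proof.
move=> gK.
suff cg : continuous g.
  apply: (measurability _ (RGenOpens.measurableE R)).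
  move=> _ [_ [a [b ->]] <-]; rewrite setTI; apply: sub_sigma_algebra => /=.
  by apply: open_comp; [move=> z _; exact: cg|exact: interval_open].
move=> z; apply/(@cvgrPdist_le _ _ _ (nbhs z)) => e e0.
pose d := e / ((`|K| + 1) * (m%:R + 1)).
have K1 : 0 < `|K| + 1 by rewrite ltr_wpDl.
have m1 : 0 < m%:R + 1 :> R by rewrite ltr_wpDl.
have d0 : 0 < d by rewrite divr_gt0// mulr_gt0.
apply/nbhs_ballP; exists d => //= z' [_ zz']; apply: le_trans (gK _ _) _.
have sd : \sum_i `|z i 0 - z' i 0| <= m%:R * d.
  rewrite mulr_natl -[X in d *+ X]card_ord -sumr_const; apply: ler_sum => i _.
  exact: ltW (zz' i 0).
apply: (@le_trans _ _ ((`|K| + 1) * ((m%:R + 1) * d))).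
  apply: (@le_trans _ _ (`|K| * (m%:R * d))).
    apply: (@le_trans _ _ (`|K| * \sum_i `|z i 0 - z' i 0|)).
      by rewrite ler_wpM2r ?ler_norm// sumr_ge0.
    by rewrite ler_wpM2l.
  apply: ler_pM => //; last by rewrite ler_wpM2r ?lerDl// ltW.
    by rewrite mulr_ge0// ltW.
  by rewrite lerDl.
by rewrite mulrA mulrCA divff ?mulr1// gt_eqF// mulr_gt0.
Qed.

End lipschitz_measurable.

Section lasso.
Context {R : realType} (n p : nat) (X : 'M[R]_(n, p)) (rankX : \rank X = p).
Local Notation G := (X^T *m X).

Lemma sqnorm_coord m (v : 'cV[R]_m) i : `|v i 0| <= Num.sqrt (sqnorm v).
Proof.
rewrite -sqrtr_sqr ler_wsqrtr// /sqnorm (bigD1 i)//= lerDl.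
by apply: sumr_ge0 => j _; exact: sqr_ge0.
Qed.

Let K : R := \sum_(j < p) \sum_(i < n) `|pinvmx X j i|.

Let K0 : 0 <= K.
Proof. by apply: sumr_ge0 => j _; exact: sumr_ge0. Qed.

(** [pinvmx X] recovers [b] from [X b]. *)
Lemma coord_le_sqnorm (b : 'cV[R]_p) j : `|b j 0| <= K * Num.sqrt (sqnorm (X *m b)).
Proof.
have -> : b j 0 = \sum_i pinvmx X j i * (X *m b) i 0.
  by rewrite -{1}[b]mul1mx -(pinvX rankX) -mulmxA mxE.
apply: le_trans (ler_norm_sum _ _ _) _.
apply: (@le_trans _ _ (\sum_i `|pinvmx X j i| * Num.sqrt (sqnorm (X *m b)))).
  by apply: ler_sum => i _; rewrite normrM ler_wpM2l// sqnorm_coord.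
rewrite -mulr_suml ler_wpM2r ?sqrtr_ge0//.
by rewrite /K (bigD1 j)//= lerDl; apply: sumr_ge0 => ? _; exact: sumr_ge0.
Qed.

Lemma sqnorm_sub_le m (u v : 'cV[R]_m) :
  sqnorm (u - v) <= 2 * sqnorm u + 2 * sqnorm v.
Proof.
rewrite /sqnorm !mulr_sumr -big_split/=; apply: ler_sum => i _.
rewrite !mxE -subr_ge0 (_ : _ - _ = (u i 0 + v i 0) ^+ 2) ?sqr_ge0//; ring.
Qed.

(** The objective is continuous, and every point where it does not exceed its
    value at [0] lies in a fixed cube; a minimizer over the cube is global. *)
Lemma lasso_kktP (lam : 'cV[R]_p) y : (forall j, 0 <= lam j 0) ->
  lasso_kkt X lam (X^T *m y) (lasso X lam y).
Proof.
move=> l0.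
pose f (b : 'cV[R]_p) := sqnorm (y - X *m b) + 2 * \sum_(j < p) lam j 0 * `|b j 0|.
suff [b fb] : exists b, forall b', f b <= f b'.
  have kb := minimizer_lasso_kkt l0 fb; by rewrite (lasso_kkt_eq rankX kb).
have pen0 (b : 'cV[R]_p) : 0 <= 2 * \sum_(j < p) lam j 0 * `|b j 0|.
  by rewrite mulr_ge0// sumr_ge0// => j _; rewrite mulr_ge0.
have f00 : f 0 = sqnorm y.
  rewrite /f mulmx0 subr0 big1 ?mulr0 ?addr0// => j _.
  by rewrite mxE normr0 mulr0.
pose M := K * Num.sqrt (4 * sqnorm y).
have bM b : f b <= f 0 -> forall j, `|b j 0| <= M.
  rewrite f00 => fb j; apply: le_trans (coord_le_sqnorm b j) _.
  rewrite ler_wpM2l// ler_wsqrtr//.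
  have := sqnorm_sub_le y (y - X *m b); rewrite opprB addrC subrK.
  have := pen0 b; move: fb; rewrite /f; lra.
pose g (c : 'rV[R]_p) := f c^T.
pose A : set 'rV[R]_p := [set c | forall i, `[- M, M]%classic (c ord0 i)].
have M0 : 0 <= M by rewrite mulr_ge0 ?sqrtr_ge0.
have [c _ cA] : exists2 c, c \in A & forall t, t \in A -> g c <= g t.
  apply: (@EVT_min_rV R p g A).
  - by exists 0 => i /=; rewrite in_itv/= mxE oppr_le0 M0.
  - by apply: (@rV_compact R p (fun=> `[- M, M]%classic)) => i; exact: segment_compact.
  - apply: continuous_subspaceT.
    have cs (I : finType) (F : I -> 'rV[R]_p -> R) :
        (forall i, continuous (F i)) -> continuous (fun c => \sum_i F i c).
      by move=> cF; apply: continuous_big => //; exact: add_continuous.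
    have -> : g = (fun c => \sum_i (y i 0 - \sum_j X i j * c ord0 j) ^+ 2 +
        2 * \sum_j lam j 0 * `|c ord0 j|).
      apply/funext => c; rewrite /g /f /sqnorm; congr (_ + 2 * _).
        apply: eq_bigr => i _; rewrite !mxE; congr ((_ - _) ^+ 2).
        by apply: eq_bigr => j _; rewrite mxE.
      by apply: eq_bigr => j _; rewrite mxE.
    have cc j : continuous (fun c : 'rV[R]_p => c ord0 j) by exact: coord_continuous.
    have c1 i : continuous (fun c : 'rV[R]_p => y i 0 - \sum_j X i j * c ord0 j).
      move=> c; apply: (@continuousB _ _ _ (fun=> y i 0)); first exact: cst_continuous.
      apply: (cs _ (fun j (c : 'rV[R]_p) => X i j * c ord0 j)) => j c'.
      by apply: (@continuousM _ _ (fun=> X i j)); [exact: cst_continuous|exact: cc].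
    have c2 : continuous (fun c : 'rV[R]_p => \sum_j lam j 0 * `|c ord0 j|).
      apply: (cs _ (fun j (c : 'rV[R]_p) => lam j 0 * `|c ord0 j|)) => j c'.
      apply: (@continuousM _ _ (fun=> lam j 0) (fun c : 'rV[R]_p => `|c ord0 j| : R));
        first exact: cst_continuous.
      exact: (continuous_comp (cc j c') (@norm_continuous _ R^o _)).
    have c3 : continuous (fun c : 'rV[R]_p =>
        \sum_i (y i 0 - \sum_j X i j * c ord0 j) ^+ 2).
      apply: (cs _ (fun i (c : 'rV[R]_p) =>
        (y i 0 - \sum_j X i j * c ord0 j) ^+ 2)) => i c.
      exact: (continuous_comp (c1 i c) (@exprn_continuous _ 2 _)).
    move=> c; apply: (@continuousD _ _ _ _ _ c (c3 c)).
    by apply: (@continuousM _ _ (fun=> 2)); [exact: cst_continuous|exact: c2].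
exists c^T => b; have [fb|/ltW fb] := leP (f b) (f 0).
  have := cA b^T; rewrite /g trmxK; apply; rewrite inE => i /=.
  by rewrite in_itv/= mxE -ler_norml bM.
apply: le_trans fb; have := cA 0; rewrite /g trmx0; apply; rewrite inE => i /=.
by rewrite in_itv/= mxE oppr_le0 M0.
Qed.

(** The subgradients of a convex penalty are monotone: pairing the difference
    [u] of the solutions with the difference of the stationarity equations bounds
    [sqnorm (X u)], which dominates [u] by full rank, by the change in [v] and
    [lam] times [u]. *)
Lemma lasso_kkt_lip (lam v b lam' v' b' : 'cV[R]_p) j :
  lasso_kkt X lam v b -> lasso_kkt X lam' v' b' ->
  `|b j 0 - b' j 0| <= K ^+ 2 *
    \sum_i (`|v i 0 - v' i 0| + `|lam i 0 - lam' i 0|).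
Proof.
move=> kb kb'; set E := \sum__ _.
have E0 : 0 <= E by apply: sumr_ge0 => i _; exact: addr_ge0.
pose u := b - b'; pose S := Num.sqrt (sqnorm (X *m u)).
have uS i : `|u i 0| <= K * S by exact: coord_le_sqnorm.
have S0 : 0 <= S by exact: sqrtr_ge0.
have uE i : u i 0 = b i 0 - b' i 0 by rewrite !mxE.
have SE : S ^+ 2 <= K * S * E.
  rewrite sqr_sqrtr ?sqnorm_ge0// -quad_form_factor /quad_form -mulmxA dotE.
  rewrite mulr_sumr; apply: ler_sum => i _.
  apply: (@le_trans _ _ (`|u i 0| * (`|v i 0 - v' i 0| + `|lam i 0 - lam' i 0|))); last first.
    by rewrite ler_wpM2r// addr_ge0.
  set r := v - G *m b; set r' := v' - G *m b'.
  have -> : (G *m u) i 0 = (v i 0 - v' i 0) - (r i 0 - r' i 0).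
    rewrite /r /r' mulmxBr; move: (G *m b) (G *m b') => g1 g2.
    by rewrite !mxE; ring.
  have [rl rb] := kb i; have [rl' rb'] := kb' i.
  rewrite -/r in rl rb; rewrite -/r' in rl' rb'.
  have h1 : r i 0 * b' i 0 <= lam i 0 * `|b' i 0|.
    by rewrite (le_trans (ler_norm _))// normrM ler_wpM2r.
  have h2 : r' i 0 * b i 0 <= lam' i 0 * `|b i 0|.
    by rewrite (le_trans (ler_norm _))// normrM ler_wpM2r.
  have h3 : u i 0 * (v i 0 - v' i 0) <= `|u i 0| * `|v i 0 - v' i 0|.
    by rewrite (le_trans (ler_norm _))// normrM.
  have h4 : (lam' i 0 - lam i 0) * (`|b i 0| - `|b' i 0|) <= `|u i 0| * `|lam i 0 - lam' i 0|.
    rewrite (le_trans (ler_norm _))// normrM mulrC [`|lam i 0 - _|]distrC ler_wpM2r//.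
    by rewrite uE ler_dist_dist.
  rewrite mulrBr [leRHS]mulrDr; apply: (@le_trans _ _ (`|u i 0| * `|v i 0 - v' i 0| +
     (lam' i 0 - lam i 0) * (`|b i 0| - `|b' i 0|))); last by rewrite lerD2l.
  rewrite lerD// -subr_ge0 uE.
  move: h1 h2 rb rb'; move: (r i 0) (r' i 0) (b i 0) (b' i 0) (lam i 0) (lam' i 0).
  by move=> x1 x2 x3 x4 x5 x6 h1 h2 h5 h6; nra.
rewrite -uE; apply: le_trans (uS j) _; rewrite expr2 -mulrA ler_wpM2l//.
have [->|S1] := eqVneq S 0; first by rewrite mulr_ge0.
by rewrite -(@ler_pM2r _ S) ?lt_neqAle 1?eq_sym ?S1// -expr2 mulrAC.
Qed.

Lemma measurable_sigma_hat : measurable_fun setT (sigma_hat X).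
Proof.
rewrite (_ : sigma_hat X = fun y : 'cV[R]_n =>
    Num.sqrt (sqnorm ((1%:M - X *m invmx G *m X^T) *m y + 0) / (n - p)%:R)); last first.
  apply/funext => y; rewrite sigma_hatE// addr0 mulmxBl mul1mx.
  by rewrite !mulmxA.
apply: (measurableT_comp (continuous_measurable_fun (@sqrt_continuous R))).
apply: measurable_funM => //.
exact: (measurableT_comp (@measurable_sqnorm R n) (measurable_affine _ _)).
Qed.

(** The Lasso is a Lipschitz function [Phi] of the pair [(X^T y, lam)]. As
    [Phi] must be defined on the whole space, its second argument enters through
    its absolute value. *)
Lemma measurable_lasso d (T : measurableType d)
    (lam : T -> 'cV[R]_p) (y : T -> 'cV[R]_n) :
  (forall t j, 0 <= lam t j 0) ->
  measurable_fun setT lam -> measurable_fun setT y ->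
  measurable_fun setT (fun t => lasso X (lam t) (y t)).
Proof.
move=> l0 ml my.
pose al (z : 'cV[R]_(p + p)) : 'cV[R]_p := \col_j `|z (rshift p j) 0|.
pose vz (z : 'cV[R]_(p + p)) : 'cV[R]_p := usubmx z.
pose Phi z := lasso X (al z) (X *m (invmx G *m vz z)).
have kPhi z : lasso_kkt X (al z) (vz z) (Phi z).
  have := @lasso_kktP (al z) (X *m (invmx G *m vz z)).
  rewrite mulmxA mulKVmx ?(gram_unit rankX)//; apply => j.
  by rewrite mxE.
apply: measurable_fun_col => j.
have -> : (fun t => lasso X (lam t) (y t) j 0) =
  (fun z => Phi z j 0) \o (fun t => col_mx (X^T *m y t) (lam t)).
  apply/funext => t /=; congr (fun_of_matrix _ _ _).
  apply: (lasso_kkt_eq rankX).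
  have := kPhi (col_mx (X^T *m y t) (lam t)); rewrite /vz col_mxKu.
  rewrite (_ : al _ = lam t)//; apply/colP => i.
  by rewrite mxE col_mxEd ger0_norm.
apply: measurableT_comp.
  apply: (@lipschitz_measurable _ _ _ (K ^+ 2)) => z z'.
  apply: le_trans (lasso_kkt_lip j (kPhi z) (kPhi z')) _.
  rewrite ler_wpM2l ?sqr_ge0// big_split_ord/= -big_split/=.
  apply: ler_sum => i _; rewrite /vz !mxE lerD2l.
  exact: ler_dist_dist.
apply: measurable_fun_col => i; rewrite -(fintype.splitK i); case: (fintype.split i) => k /=.
  under eq_fun do rewrite col_mxEu.
  have := measurableT_comp (measurable_coord k) (measurableT_comp (measurable_affine X^T 0) my).
  by congr measurable_fun; apply/funext => t /=; rewrite addr0.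
under eq_fun do rewrite col_mxEd.
exact: (measurableT_comp (measurable_coord k) ml).
Qed.

End lasso.

(** * Ratio of a Gaussian vector and an independent norm *)
Section ratio.
Context {R : realType}.

Lemma leb_set0col k : (0 < k)%N -> leb k [set (0 : 'cV[R]_k)] = 0%E.
Proof.
case: k => // k _.
have -> : [set (0 : 'cV[R]_k.+1)] = box (fun=> [set 0%R]).
  apply/seteqP; split=> v /=; first by move=> -> i; rewrite mxE.
  by move=> v0; apply/colP => i; rewrite v0 mxE.
rewrite /leb lebesgue_col_box; last by move=> i; exact: measurable_set1.
by rewrite big_ord_recl/= lebesgue_measure_set1 mul0e.
Qed.

Lemma measurable_set0col k : measurable [set (0 : 'cV[R]_k)].
Proof.
have -> : [set (0 : 'cV[R]_k)] = box (fun=> [set 0%R]).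
  apply/seteqP; split=> v /=; first by move=> -> i; rewrite mxE.
  by move=> v0; apply/colP => i; rewrite v0 mxE.
by apply: measurable_box => i; exact: measurable_set1.
Qed.

Lemma eq_integral_off0 k (f g : 'cV[R]_k -> \bar R) : (0 < k)%N ->
  measurable_fun setT f -> measurable_fun setT g ->
  (forall z, z != 0 -> f z = g z) ->
  (\int[leb k]_z f z = \int[leb k]_z g z)%E.
Proof.
move=> k0 mf mg fg; apply: ae_eq_integral => //.
exists [set 0]; split; [exact: measurable_set0col|exact: leb_set0col|].
move=> z /= /not_implyP[_ fgz]; apply/eqP/negP => /negP z0; exact: fgz (fg z z0).
Qed.

Lemma measurable_inv_ge0 d (T : measurableType d) (f : T -> R) :
  (forall t, 0 <= f t) -> measurable_fun setT f ->
  measurable_fun setT (fun t => (f t)^-1).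
Proof.
move=> f0 mf; have := measurableT_comp (@measurable_powR R (-1)) mf.
by congr measurable_fun; apply/funext => t /=; rewrite powR_inv1.
Qed.

Lemma quad_formZ n (C : 'M[R]_n) a v : quad_form C (a *: v) = a ^+ 2 * quad_form C v.
Proof.
rewrite /quad_form [(a *: v)^T]linearZ/= -scalemxAr -!scalemxAl.
by rewrite scalerA mxE expr2.
Qed.

Definition qnorm k (D : 'M[R]_k) (z : 'cV[R]_k) : R := Num.sqrt (quad_form D z).

Lemma measurable_qnorm k (D : 'M[R]_k) : measurable_fun setT (qnorm D).
Proof.
apply: measurableT_comp (measurable_quad_form D).
by apply: continuous_measurable_fun; exact: sqrt_continuous.
Qed.

Lemma posdef_ge0 k (D : 'M[R]_k) z : posdef D -> 0 <= quad_form D z.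
Proof.
move=> pD; have [->|z0] := eqVneq z 0; last by rewrite ltW// pD.
by rewrite /quad_form mulmx0 mxE.
Qed.

Lemma qnormZ k (D : 'M[R]_k) a z : 0 <= a -> qnorm D (a *: z) = a * qnorm D z.
Proof. by move=> a0; rewrite /qnorm quad_formZ sqrtrM ?sqr_ge0// sqrtr_sqr ger0_norm. Qed.

(** Substituting [z / sqrt c] for [z]: the norm is homogeneous of degree one and
    the volume of degree [k]. *)
Lemma radial_scale k (D : 'M[R]_k) p (e c : R) : 0 < c ->
  (\int[leb k]_z (qnorm D z ^+ p * expR (- (qnorm D z ^+ 2 * (c * e))))%:E =
   (c `^ (- ((k + p)%:R / 2)))%:E *
   \int[leb k]_z (qnorm D z ^+ p * expR (- (qnorm D z ^+ 2 * e)))%:E)%E.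
Proof.
move=> c0; pose a := (Num.sqrt c)^-1.
have a0 : 0 < a by rewrite invr_gt0 sqrtr_gt0.
pose g z := (qnorm D z ^+ p * expR (- (qnorm D z ^+ 2 * (c * e))))%:E.
have := @linear_change_unit R k a%:M _ 0 g.
rewrite det_scalar expf_neq0 ?gt_eqF// => /(_ isT _ _) <-; last 2 first.
- apply/measurable_EFinP; apply: measurable_funM.
    by apply: measurable_funX; exact: measurable_qnorm.
  apply: measurableT_comp => //; apply: measurableT_comp => //.
  by apply: measurable_funM => //; apply: measurable_funX; exact: measurable_qnorm.
- by move=> z; rewrite lee_fin mulr_ge0 ?expR_ge0// exprn_ge0// sqrtr_ge0.
rewrite ger0_norm ?exprn_ge0 ?(ltW a0)//.
have -> : c `^ (- ((k + p)%:R / 2)) = a ^+ k * a ^+ p.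
  by rewrite -exprD /a exprVn sqrt_exprn_powR// powRN.
rewrite EFinM -muleA; congr *%E.
rewrite -ge0_integralZl_EFin ?exprn_ge0 ?(ltW a0)//; last 2 first.
- by move=> z _; rewrite lee_fin mulr_ge0 ?expR_ge0// exprn_ge0// sqrtr_ge0.
- apply/measurable_EFinP; apply: measurable_funM.
    by apply: measurable_funX; exact: measurable_qnorm.
  apply: measurableT_comp => //; apply: measurableT_comp => //.
  by apply: measurable_funM => //; apply: measurable_funX; exact: measurable_qnorm.
apply: eq_integral => z _; rewrite addr0 mul_scalar_mx /g qnormZ ?(ltW a0)//.
rewrite -EFinM !exprMn; congr EFin; rewrite [RHS]mulrA; congr (_ * expR (- _)).
rewrite /a exprVn sqr_sqrtr ?(ltW c0)//; field; exact: lt0r_neq0.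
Qed.

(** For fixed [z] the inner integral is transformed by the linear substitution
    [t = (a / qnorm D z) u + m], under which the exponent becomes
    [qnorm D z ^+ 2 * (quad_form C (t - m) + k) * e]. After exchanging the
    integrals, [radial_scale] with [c = 1 + quad_form C (t - m) / k] evaluates
    the integral over [z] up to a factor that does not depend on [t]. The
    constant [kappa] is left unspecified, because the total mass determines it
    afterwards. *)
Lemma ratio_law p k (C : 'M[R]_p) (D : 'M[R]_k) (m : 'cV[R]_p) (a e : R) :
  (0 < k)%N -> posdef C -> posdef D -> 0 < a ->
  exists2 kappa : \bar R, (0 <= kappa)%E & forall M : set 'cV[R]_p, measurable M ->
  (\int[leb k]_z \int[leb p]_u
     (\1_M ((a / qnorm D z) *: u + m) *
      expR (- ((a ^+ 2 * quad_form C u + k%:R * qnorm D z ^+ 2) * e)))%:E =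
   kappa * \int[leb p]_t (\1_M t *
      (1 + quad_form C (t - m) / k%:R) `^ (- ((k + p)%:R / 2)))%:E)%E.
Proof.
move=> k0 pC pD a0.
have kR0 : 0 < k%:R :> R by rewrite ltr0n.
pose s z := qnorm D z; have s0 z : 0 <= s z by exact: sqrtr_ge0.
have ms : measurable_fun setT s by exact: measurable_qnorm.
pose I := (\int[leb k]_z (s z ^+ p * expR (- (s z ^+ 2 * (k%:R * e))))%:E)%E.
exists ((a^-1 ^+ p)%:E * I)%E.
  rewrite mule_ge0 ?lee_fin ?exprn_ge0 ?invr_ge0 ?(ltW a0)//.
  by apply: integral_ge0 => z _; rewrite lee_fin mulr_ge0 ?expR_ge0 ?exprn_ge0.
move=> M mM.
pose h (z : 'cV[R]_k) (t : 'cV[R]_p) : R :=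
  \1_M t * expR (- (s z ^+ 2 * (quad_form C (t - m) + k%:R) * e)).
have h0 z t : 0 <= h z t by rewrite mulr_ge0 ?expR_ge0.
have mh : measurable_fun setT (fun zt => h zt.1 zt.2).
  apply: measurable_funM.
    by apply: measurableT_comp measurable_snd; exact: measurable_indic.
  apply: measurableT_comp => //; apply: measurableT_comp => //.
  apply: measurable_funM => //; apply: measurable_funM.
    by apply: measurable_funX; exact: measurableT_comp ms measurable_fst.
  apply: measurable_funD => //.
  exact: measurableT_comp (measurable_quad_form_sub C m) measurable_snd.
have msh : measurable_fun setT (fun zt : 'cV[R]_k * 'cV[R]_p =>
    ((s zt.1 / a) ^+ p * h zt.1 zt.2)%:E).
  apply/measurable_EFinP; apply: measurable_funM => //.
  apply: measurable_funX; apply: measurable_funM => //.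
  exact: measurableT_comp ms measurable_fst.
have sh0 z t : (0 <= ((s z / a) ^+ p * h z t)%:E)%E.
  by rewrite lee_fin mulr_ge0// exprn_ge0// divr_ge0 ?(ltW a0).
have mh2 z : measurable_fun setT (fun t => (h z t)%:E).
  by apply/measurable_EFinP; exact: (measurableT_comp mh (pair1_measurable z)).
have mf : measurable_fun setT (fun zu : 'cV[R]_k * 'cV[R]_p =>
    (\1_M ((a / qnorm D zu.1) *: zu.2 + m) * expR
      (- ((a ^+ 2 * quad_form C zu.2 + k%:R * qnorm D zu.1 ^+ 2) * e)))%:E).
  apply/measurable_EFinP; apply: measurable_funM.
    apply: measurableT_comp; first exact: measurable_indic.
    apply: measurable_fun_col => i.
    under eq_fun do rewrite !mxE.
    apply: measurable_funD => //; apply: measurable_funM; last first.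
      exact: measurableT_comp (measurable_coord i) measurable_snd.
    apply: measurable_funM => //.
    exact: measurableT_comp (measurable_inv_ge0 s0 ms) measurable_fst.
  apply: measurableT_comp => //; apply: measurableT_comp => //.
  apply: measurable_funM => //; apply: measurable_funD.
    apply: measurable_funM => //.
    exact: measurableT_comp (measurable_quad_form C) measurable_snd.
  apply: measurable_funM => //; apply: measurable_funX.
  exact: measurableT_comp ms measurable_fst.
transitivity (\int[leb k]_z \int[leb p]_t ((s z / a) ^+ p * h z t)%:E)%E.
  apply: eq_integral_off0 => //.
  - apply: (measurable_fun_fubini_tonelli_F _ mf) => zu.
    by rewrite lee_fin mulr_ge0 ?expR_ge0.
  - by apply: (measurable_fun_fubini_tonelli_F _ msh) => zu; exact: sh0.
  move=> z z0; have sz0 : 0 < s z by rewrite sqrtr_gt0 pD.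
  have asz : 0 < a / s z by rewrite divr_gt0.
  have := @linear_change_unit R p (a / s z)%:M _ m (fun t => (h z t)%:E).
  rewrite det_scalar expf_neq0 ?(gt_eqF asz)// => /(_ isT _ _) E.
  under [RHS]eq_integral do rewrite EFinM.
  rewrite ge0_integralZl_EFin//; last 2 first.
  - by move=> t _; rewrite lee_fin.
  - by rewrite exprn_ge0// divr_ge0 ?(ltW a0).
  rewrite -E; last 2 first.
  - exact: mh2.
  - by move=> t; rewrite lee_fin.
  rewrite muleA -EFinM ger0_norm ?exprn_ge0 ?(ltW asz)// -exprMn.
  have -> : s z / a * (a / s z) = 1 by field; rewrite !gt_eqF.
  rewrite expr1n mul1e.
  apply: eq_integral => u _; rewrite /h mul_scalar_mx addrK quad_formZ.
  congr EFin; congr (_ * expR (- _)); rewrite -/(s z); field; exact: lt0r_neq0.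
rewrite (fubini_tonelli (fun zt : 'cV[R]_k * 'cV[R]_p =>
  ((s zt.1 / a) ^+ p * h zt.1 zt.2)%:E)); last 2 first.
- exact: msh.
- by move=> zt; exact: sh0.
rewrite -ge0_integralZl//; last 3 first.
- apply/measurable_EFinP; apply: measurable_funM; first exact: measurable_indic.
  exact: measurable_mvt_kernel.
- by move=> t _; rewrite lee_fin mulr_ge0 ?powR_ge0.
- rewrite mule_ge0 ?lee_fin ?exprn_ge0 ?invr_ge0 ?(ltW a0)//.
  by apply: integral_ge0 => z _; rewrite lee_fin mulr_ge0 ?expR_ge0 ?exprn_ge0.
apply: eq_integral => t _ /=.
pose c := 1 + quad_form C (t - m) / k%:R.
have c0 : 0 < c by rewrite ltr_wpDr// divr_ge0 ?posdef_ge0 ?ler0n.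
transitivity ((\1_M t * a^-1 ^+ p)%:E * \int[leb k]_z
    (s z ^+ p * expR (- (s z ^+ 2 * (c * (k%:R * e)))))%:E)%E.
  rewrite -ge0_integralZl_EFin//; last 3 first.
  - by move=> z _; rewrite lee_fin mulr_ge0 ?expR_ge0 ?exprn_ge0.
  - apply/measurable_EFinP; apply: measurable_funM; first exact: measurable_funX.
    apply: measurableT_comp => //; apply: measurableT_comp => //.
    by apply: measurable_funM => //; exact: measurable_funX.
  - by rewrite mulr_ge0// exprn_ge0// invr_ge0 ltW.
  apply: eq_integral => z _; rewrite -EFinM; congr EFin.
  rewrite /h exprMn (_ : s z ^+ 2 * (c * _) = s z ^+ 2 * (quad_form C (t - m) + k%:R) * e).
    by ring.
  by rewrite /c; field; exact: lt0r_neq0.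
rewrite radial_scale// -/I -/c.
rewrite muleA -EFinM [RHS]muleAC -!EFinM; congr (_%:E * _)%E; ring.
Qed.

End ratio.

(** * The law of the studentized least-squares error *)
Section law_of_t.
Context {R : realType}.

Lemma integral_indicM d (T : measurableType d)
    (mu : {measure set T -> \bar R}) (A : set T) (f : T -> R) :
  (\int[mu]_(x in A) (f x)%:E = \int[mu]_x (\1_A x * f x)%:E)%E.
Proof.
rewrite integral_mkcond; congr (integral _ _ _); apply/funext => x.
by rewrite patchE indicE; case: ifP => _; rewrite ?mul1r ?mul0r.
Qed.

(** The left kernel of [X] has dimension [n - p] by the rank formula. *)
Lemma orthogonal_complement n p (X : 'M[R]_(n, p)) : \rank X = p ->
  exists B : 'M[R]_(n, n - p), X^T *m B = 0 /\ \rank B = (n - p)%N.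
Proof.
move=> rX.
have e : \rank (kermx X) = (n - p)%N by rewrite mxrank_ker rX.
suff : exists B : 'M[R]_(n, \rank (kermx X)), X^T *m B = 0 /\ \rank B = \rank (kermx X).
  by rewrite e.
exists (row_base (kermx X))^T; split.
  rewrite -trmx_mul; apply/eqP; rewrite trmx_eq0; apply/eqP.
  by apply/sub_kermxP; rewrite eq_row_base.
by rewrite mxrank_tr eq_row_base.
Qed.

Context (p k : nat) (X : 'M[R]_(p + k, p)) (rankX : \rank X = p) (k0 : (0 < k)%N).
Context (s2 : R).
Local Notation G := (X^T *m X).
Local Notation n := (p + k)%N.
Let e : R := (2 * s2)^-1.

(** The constant is left unspecified: a total mass determines it later. *)
Lemma mvnormal_pdfE : exists2 c : R, 0 <= c &
  forall x : 'cV[R]_n, mvnormal_pdf 0 s2%:M x = c * expR (- (sqnorm x * e)).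
Proof.
eexists; last first.
  move=> x; rewrite /mvnormal_pdf; congr (_ * expR (- _)).
  rewrite invmx_scalar subr0 /quad_form -scalemx1 -scalemxAr -scalemxAl mulmx1.
  by rewrite mxE -sqnormE /e invfM; ring.
by rewrite invr_ge0 mulr_ge0 ?powR_ge0 ?sqrtr_ge0.
Qed.

Context (B : 'M[R]_(n, k)) (XB : X^T *m B = 0) (rankB : \rank B = k).

Let T : 'M[R]_n := row_mx X B.

Lemma BX : B^T *m X = 0.
Proof. by rewrite -[X in _ *m X]trmxK -trmx_mul XB trmx0. Qed.

Lemma T_unit : \det T != 0.
Proof.
suff : \det (T^T *m T) != 0.
  by rewrite det_mulmx det_tr; apply: contra_neq => ->; rewrite mul0r.
rewrite /T tr_row_mx mul_col_row XB BX det_ublock mulf_neq0//.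
  by rewrite gt_eqF// det_posdef_gt0 ?gram_sym//; exact: gram_posdef.
by rewrite gt_eqF// det_posdef_gt0 ?gram_sym//; exact: gram_posdef.
Qed.

Lemma mulT_col_mx (u : 'cV[R]_p) (z : 'cV[R]_k) : T *m col_mx u z = X *m u + B *m z.
Proof. by rewrite mul_row_col. Qed.

Lemma sqnormT (u : 'cV[R]_p) (z : 'cV[R]_k) :
  sqnorm (X *m u + B *m z) = sqnorm (X *m u) + sqnorm (B *m z).
Proof.
have sN : sqnorm (- (B *m z)) = sqnorm (B *m z).
  by apply: eq_bigr => i _; rewrite [in LHS]mxE sqrrN.
have := sqnorm_sub (X *m u) (- (B *m z)); rewrite opprK sN => ->.
have E : (X *m u)^T *m (- (B *m z)) = 0.
  by rewrite trmx_mul mulmxN -mulmxA [X^T *m _]mulmxA XB mul0mx mulmx0 oppr0.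
by rewrite -dotE [in LHS]E mxE mulr0 subr0.
Qed.

(** In the coordinates [x = X u + B z], with [X] and [B] orthogonal, the normal
    density is a product of a function of [u] and one of [z]. *)
Lemma gaussian_split : exists2 c : R, 0 <= c &
  forall A : set 'cV[R]_n, measurable A ->
  (mvnormal_prob 0 s2%:M A = c%:E * \int[leb k]_z \int[leb p]_u
    (\1_A (X *m u + B *m z)%R *
     expR (- ((sqnorm (X *m u) + sqnorm (B *m z)) * e)))%:E)%E.
Proof.
have [c c0 pdfE] := mvnormal_pdfE.
exists (`|\det T| * c); first by rewrite mulr_ge0.
move=> A mA.
have -> : mvnormal_prob 0 s2%:M A =
    (\int[leb n]_x (\1_A x * mvnormal_pdf 0 s2%:M x)%:E)%E.
  exact: (integral_indicM (lebesgue_col n)).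
pose f x := (\1_A x * expR (- (sqnorm x * e)))%:E.
have mf : measurable_fun setT (f : 'cV[R]_n -> \bar R).
  apply/measurable_EFinP; apply: measurable_funM; first exact: measurable_indic.
  apply: measurableT_comp => //; apply: measurableT_comp => //.
  by apply: measurable_funM => //; exact: measurable_sqnorm.
have f0 x : (0 <= f x)%E by rewrite lee_fin mulr_ge0 ?expR_ge0.
transitivity (c%:E * \int[leb n]_x f x)%E.
  rewrite -(ge0_integralZl_EFin _ measurableT (fun x _ => f0 x) mf c0).
  by apply: eq_integral => x _; rewrite pdfE -EFinM mulrCA.
have mTf := measurableT_comp mf (measurable_affine T 0).
rewrite -(linear_change_unit T_unit 0 mf f0) EFinM muleA [(c%:E * _)%E]muleC.
congr *%E; rewrite (integral_leb_col_mx_swap mTf) => [|v]; last exact: f0.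
apply: eq_integral => z _; apply: eq_integral => u _.
by rewrite /= addr0 mulT_col_mx /f sqnormT.
Qed.

Let D : 'M[R]_k := k%:R^-1 *: (B^T *m B).
Let C : 'M[R]_p := gram_mx X.

Let kR0 : 0 < k%:R :> R. Proof. by rewrite ltr0n. Qed.
Let n0 : (0 < n)%N. Proof. by rewrite addn_gt0 k0 orbT. Qed.
Let nR0 : 0 < n%:R :> R. Proof. by rewrite ltr0n addn_gt0 k0 orbT. Qed.

Lemma D_posdef : posdef D.
Proof.
move=> v v0; rewrite /D /quad_form -scalemxAr -scalemxAl mxE.
by rewrite mulr_gt0 ?invr_gt0//; exact: gram_posdef.
Qed.

Lemma sqnormX u : sqnorm (X *m u) = n%:R * quad_form C u.
Proof.
rewrite -quad_form_factor /C /gram_mx /quad_form -scalemxAr -scalemxAl [in RHS]mxE.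
by rewrite mulrA divff ?mul1r// gt_eqF.
Qed.

Lemma sqnormB z : sqnorm (B *m z) = k%:R * qnorm D z ^+ 2.
Proof.
rewrite sqr_sqrtr ?posdef_ge0//; last exact: D_posdef.
rewrite -quad_form_factor /D /quad_form -scalemxAr -scalemxAl [in RHS]mxE.
by rewrite mulrA divff ?mul1r// gt_eqF.
Qed.

Lemma lsT (u : 'cV[R]_p) (z : 'cV[R]_k) : invmx G *m (X^T *m (X *m u + B *m z)) = u.
Proof.
rewrite [X^T *m (_ + _)]mulmxDr [X^T *m (X *m u)]mulmxA [X^T *m (B *m z)]mulmxA XB.
by rewrite mul0mx addr0 mulKmx// gram_unit.
Qed.

Lemma sigma_hatT (u : 'cV[R]_p) (z : 'cV[R]_k) :
  sigma_hat X (X *m u + B *m z) = qnorm D z.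
Proof.
rewrite sigma_hatE// lsT addrC addKr sqnormB addKn mulrAC divff ?gt_eqF// mul1r.
by rewrite sqrtr_sqr ger0_norm// sqrtr_ge0.
Qed.

(** In the coordinates [x = X u + B z] the least-squares coefficient is [u] and
    the scale estimate is a norm of [z], so this is the ratio of [ratio_law]. *)
Definition tstat (m : 'cV[R]_p) (x : 'cV[R]_n) : 'cV[R]_p :=
  (Num.sqrt n%:R / sigma_hat X x) *: (invmx G *m (X^T *m x)) + m.

Lemma measurable_tstat m : measurable_fun setT (tstat m).
Proof.
apply: measurable_fun_col => i.
under eq_fun do rewrite /tstat mxE [X in X + _]mxE.
apply: measurable_funD => //; apply: measurable_funM.
  apply: measurable_funM => //; apply: measurable_inv_ge0.
    by move=> x; exact: sigma_hat_ge0.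
  exact: (measurable_sigma_hat rankX).
have := measurableT_comp (measurable_coord i) (measurable_affine (invmx G *m X^T) 0).
by congr measurable_fun; apply/funext => x /=; rewrite addr0 mulmxA.
Qed.

Lemma tstat_law_kernel m : exists2 kappa : \bar R, (0 <= kappa)%E &
  forall M : set 'cV[R]_p, measurable M ->
  (mvnormal_prob 0 s2%:M (tstat m @^-1` M) = kappa * \int[leb p]_t (\1_M t *
      (1 + quad_form C (t - m) / k%:R) `^ (- ((k + p)%:R / 2)))%:E)%E.
Proof.
have [c c0 split] := gaussian_split.
have a0 : 0 < Num.sqrt n%:R :> R by rewrite sqrtr_gt0.
have [kappa kappa0 law] := ratio_law m e k0 (gram_mx_posdef rankX n0) D_posdef a0.
exists (c%:E * kappa)%E; first by rewrite mule_ge0// lee_fin.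
move=> M mM; rewrite split; last first.
  by rewrite -[X in measurable X]setTI; exact: measurable_tstat.
rewrite -muleA.
rewrite -(law M mM).
apply: (congr1 (fun I => c%:E * I)%E).
apply: eq_integral => z _.
apply: eq_integral => u _.
have sn : Num.sqrt n%:R ^+ 2 = n%:R :> R by rewrite sqr_sqrtr ?ler0n.
rewrite sqnormX sqnormB sn.
congr EFin; congr (_ * _).
have E : tstat m (X *m u + B *m z) = (Num.sqrt n%:R / qnorm D z) *: u + m.
  by rewrite /tstat sigma_hatT lsT.
by rewrite -E !indicE.
Qed.

(** The scale estimate vanishes only for [z = 0], a null set because [0 < k]. *)
Lemma sigma_hat_null : mvnormal_prob 0 s2%:M [set x | sigma_hat X x = 0] = 0%E.
Proof.
have mN : measurable [set x | sigma_hat X x = 0].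
  have := measurable_sigma_hat rankX measurableT (measurable_set1 0).
  by rewrite setTI.
have [c c0 split] := gaussian_split.
have mj : measurable_fun setT (fun zu : 'cV[R]_k * 'cV[R]_p =>
    X *m zu.2 + B *m zu.1).
  have := measurableT_comp (measurable_affine T 0)
    (measurableT_comp (@measurable_pair_col R p k) (@measurable_swap _ _ 'cV[R]_k 'cV[R]_p)).
  by congr measurable_fun; apply/funext => -[z u] /=; rewrite addr0 mulT_col_mx.
pose f (zu : 'cV[R]_k * 'cV[R]_p) :=
  (\1_[set x | sigma_hat X x = 0] (X *m zu.2 + B *m zu.1) *
   expR (- ((sqnorm (X *m zu.2) + sqnorm (B *m zu.1)) * e)))%:E.
have mf : measurable_fun setT f.
  apply/measurable_EFinP; apply: measurable_funM.
    by apply: measurableT_comp mj; exact: measurable_indic.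
  apply: measurableT_comp => //; apply: measurableT_comp => //.
  apply: measurable_funM => //.
  under eq_fun do rewrite -sqnormT.
  exact: measurableT_comp (@measurable_sqnorm R n) mj.
have f0 zu : (0 <= f zu)%E by rewrite lee_fin mulr_ge0 ?expR_ge0.
rewrite (split _ mN) (@eq_integral_off0 _ _ _ (cst 0%E) k0).
- by rewrite integral0 mule0.
- exact: (measurable_fun_fubini_tonelli_F _ mf f0).
- exact: measurable_cst.
move=> z z0; apply: integral0_eq => u _; rewrite indicE memNset ?mul0r//=.
by apply/eqP; rewrite sigma_hatT gt_eqF// sqrtr_gt0; exact: D_posdef.
Qed.

(** Both laws are proportional to the same kernel, and both have total mass
    one. *)
Lemma tstat_law m M : mvnormal_prob 0 s2%:M [set: 'cV[R]_n] = 1%E ->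
  measurable M ->
  mvnormal_prob 0 s2%:M (tstat m @^-1` M) = mvt_prob k m (invmx C) M.
Proof.
move=> total mM; have [kappa kappa0 law] := tstat_law_kernel m.
pose q (t : 'cV[R]_p) : R := (1 + quad_form C (t - m) / k%:R) `^ (- ((k + p)%:R / 2)).
have mq : measurable_fun setT (fun t => (q t)%:E).
  by apply/measurable_EFinP; exact: measurable_mvt_kernel.
have q0 t : (0 <= (q t)%:E)%E by rewrite lee_fin powR_ge0.
have [c c0 cE] : exists2 c : R, 0 <= c & forall t, mvt_pdf k m (invmx C) t = c * q t.
  eexists; last by move=> t; rewrite /mvt_pdf invmxK.
  have G0 j : 0 <= gamma_fun (j%:R / 2) :> R.
    by rewrite gamma_funE fine_ge0// egamma_ge0.
  by rewrite divr_ge0// !mulr_ge0 ?powR_ge0 ?sqrtr_ge0.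
have mass : (c%:E * \int[leb p]_t (q t)%:E = 1)%E.
  rewrite -(integral_mvt_pdf m k0 (gram_mx_sym X) (gram_mx_posdef rankX n0)).
  rewrite -(ge0_integralZl_EFin _ measurableT (fun x _ => q0 x) mq c0).
  by apply: eq_integral => t _; rewrite cE EFinM.
have {total}mass' : (kappa * \int[leb p]_t (q t)%:E = 1)%E.
  rewrite -total -(preimage_setT (tstat m)) (law _ measurableT).
  apply: (congr1 (fun I => kappa * I)%E).
  by apply: eq_integral => t _; rewrite indicT mul1r.
have kc : kappa = c%:E.
  move: mass mass'; set I := (\int[_]_ _ _)%E => mass mass'.
  by rewrite -[LHS]mule1 -mass muleCA mass' mule1.
rewrite law// kc /mvt_prob.
transitivity (\int[leb p]_t (\1_M t * mvt_pdf k m (invmx C) t)%:E)%E; last first.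
  by apply/esym; exact: (integral_indicM (lebesgue_col p)).
have mM1 : measurable_fun setT (fun t => (\1_M t * q t)%:E).
  apply/measurable_EFinP; apply: measurable_funM; first exact: measurable_indic.
  exact/measurable_EFinP.
have M0 t : (0 <= (\1_M t * q t)%:E)%E by rewrite lee_fin mulr_ge0// -lee_fin.
rewrite -(ge0_integralZl_EFin _ measurableT (fun x _ => M0 x) mM1 c0).
by apply: eq_integral => t _; rewrite cE -EFinM mulrCA.
Qed.

End law_of_t.

(** * Comparison of the Lasso with the orthant minimizers *)
Section coverage.
Context {R : realType} (n p : nat) (X : 'M[R]_(n, p)).
Context (rankX : \rank X = p) (n0 : (0 < n)%N).
Local Notation G := (X^T *m X).
Local Notation C := (gram_mx X).
Local Notation rootn := (Num.sqrt n%:R : R).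

Let nR0 : 0 < n%:R :> R. Proof. by rewrite ltr0n. Qed.
Let rn0 : 0 < rootn. Proof. by rewrite sqrtr_gt0. Qed.
Let rnE : rootn ^+ 2 = n%:R. Proof. by rewrite sqr_sqrtr// ltW. Qed.

Let rnn : rootn * n%:R^-1 = rootn^-1.
Proof. by rewrite -[X in _ / X]rnE expr2 invfM mulrA divff ?gt_eqF// mul1r. Qed.

(** In this variable the stationarity equation of the Lasso has the same form as
    that of the orthant objectives ([gram_lasso_error], [gram_u_hat]). *)
Definition lasso_error lam (beta : 'cV[R]_p) (eps : 'cV[R]_n) : 'cV[R]_p :=
  rootn *: (lasso X lam (X *m beta + eps) - beta).

Lemma gram_mx_unit : C \in unitmx.
Proof.
rewrite unitmxE unitfE gt_eqF// det_posdef_gt0//; first exact: gram_mx_sym.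
exact: gram_mx_posdef.
Qed.

Lemma diag_mulE (lam d : 'cV[R]_p) j : (diag_mx lam^T *m d) j 0 = lam j 0 * d j 0.
Proof. by rewrite mul_diag_mx !mxE. Qed.

Lemma mx_subZE m q (A B : 'M[R]_(m, q)) c i j : (A - c *: B) i j = A i j - c * B i j.
Proof. by rewrite !mxE. Qed.

Lemma u_hatE lam d eps :
  u_hat X lam d eps = invmx C *m (score X eps - rootn^-1 *: (diag_mx lam^T *m d)).
Proof.
rewrite -(@argmin_quad _ _ _ _ 0); [|exact: gram_mx_sym|exact: gram_mx_posdef].
congr argmin; apply/funext => u; rewrite addr0 mulmxBr -!scalemxAr.
rewrite mx_subZE.
rewrite [(u^T *m (diag_mx _ *m _)) 0 0]dotE.
have -> : \sum_j u j 0 * (diag_mx lam^T *m d) j 0 = \sum_j lam j 0 * d j 0 * u j 0.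
  by apply: eq_bigr => j _; rewrite diag_mulE mulrC.
by ring.
Qed.

(** Stationarity of the orthant objective, in which the subgradient of the penalty
    is frozen at [lam j * d j]. *)
Lemma gram_u_hat lam d eps j :
  (C *m u_hat X lam d eps) j 0 = score X eps j 0 - rootn^-1 * (lam j 0 * d j 0).
Proof.
rewrite u_hatE mulKVmx ?gram_mx_unit//.
by rewrite mx_subZE diag_mulE.
Qed.

Lemma gram_lasso_error (lam beta : 'cV[R]_p) (eps : 'cV[R]_n) :
  let y := X *m beta + eps in
  C *m lasso_error lam beta eps =
  score X eps - rootn^-1 *: (X^T *m y - G *m lasso X lam y).
Proof.
move=> y; rewrite /lasso_error -/y /gram_mx /score -scalemxAr -scalemxAl scalerA.
rewrite rnn.
rewrite -scalerBr; congr (_ *: _).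
rewrite mulmxBr {1}/y [X^T *m (_ + _)]mulmxDr [X^T *m (X *m _)]mulmxA.
move: (G *m lasso _ _ _) (G *m beta) (X^T *m eps) => B D A.
by rewrite opprB opprD addrCA [A + _]addrCA subrr addr0.
Qed.

Lemma sign_vecE (s : {ffun 'I_p -> bool}) j : sign_vec (R := R) s j 0 = (-1) ^+ s j.
Proof. by rewrite mxE. Qed.

Lemma scale_setE (M : set 'cV[R]_p) (a : R) u : a != 0 ->
  [set a *: m | m in M] u <-> M (a^-1 *: u).
Proof.
move=> a0; split=> [[m Mm <-]|Mu]; first by rewrite scalerA mulVf// scale1r.
by exists (a^-1 *: u) => //; rewrite scalerA divff// scale1r.
Qed.

(** Let [d] be the sign vector of [beta]. Where the error has the sign [d j], the
    estimator does too, so its subgradient is [lam j * d j], as in the orthant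
    objective of [d], and the two images under the Gram matrix agree in that
    coordinate. Elsewhere [d j] times the subgradient is at most [lam j]. Hence
    flipping the signs of the former coordinates yields the sign vector [s'] for
    which Condition A, applied to the orthant minimizer, captures the error. *)
Lemma coverage_lower (M : set 'cV[R]_p) (gamma : 'cV[R]_p) (a : R)
    (beta : 'cV[R]_p) (eps : 'cV[R]_n) :
  conditionA C M -> (forall j, 0 <= gamma j 0) -> 0 <= a ->
  let s := [ffun j => beta j 0 < 0] in
  [set a *: m | m in M] (u_hat X (a *: gamma) (sign_vec s) eps) ->
  [set a *: m | m in M] (lasso_error (a *: gamma) beta eps).
Proof.
move=> condM g0 a0 s; set lam := a *: gamma; set d := sign_vec s.
have l0 j : 0 <= lam j 0 by rewrite mxE mulr_ge0.
pose y := X *m beta + eps; pose b := lasso X lam y.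
have kkt : lasso_kkt X lam (X^T *m y) b by exact: lasso_kktP.
pose r := X^T *m y - G *m b; pose uh := u_hat X lam d eps.
pose e := lasso_error lam beta eps.
have Ce j : (C *m e) j 0 = score X eps j 0 - rootn^-1 * r j 0.
  by rewrite gram_lasso_error mx_subZE.
have Cu j := gram_u_hat lam d eps j.
(* Without penalty the Lasso and the orthant minimizers coincide. *)
have [a00|an0] := eqVneq a 0.
  have lam0 j : lam j 0 = 0 by rewrite mxE a00 mul0r.
  have r0 j : r j 0 = 0.
    by have [] := kkt j; rewrite lam0 -/r normr_le0 => /eqP.
  suff -> : lasso_error lam beta eps = uh by [].
  have : C *m e = C *m uh.
    by apply/colP => j; rewrite Ce Cu r0 lam0 mul0r.
  by move=> /(congr1 (mulmx (invmx C))); rewrite !mulKmx ?gram_mx_unit.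
have ap : 0 < a by rewrite lt_neqAle eq_sym an0.
rewrite !scale_setE//.
pose s' := [ffun j => if e j 0 * d j 0 <= 0 then s j else ~~ s j].
rewrite -/uh -/e => Mu; apply: (condM s' _ Mu) => j.
have Ca (v : 'cV[R]_p) : (C *m (a^-1 *: v)) j 0 = a^-1 * (C *m v) j 0.
  by rewrite -scalemxAr mxE.
have -> : (a^-1 *: e) j 0 = a^-1 * e j 0 by rewrite mxE.
rewrite !Ca Ce Cu [sign_vec s' j 0]sign_vecE /s' ffunE.
have [rl rb] := kkt j; rewrite -/r in rl rb.
have dj : d j 0 = (-1) ^+ s j by rewrite sign_vecE.
have dd : (-1) ^+ s j * (-1) ^+ s j = 1 :> R by rewrite -expr2 sqrr_sign.
have ai : 0 < a^-1 by rewrite invr_gt0.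
have rni : 0 < rootn^-1 by rewrite invr_gt0.
have scal (D : R) : D * r j 0 <= D * (lam j 0 * d j 0) ->
   D * (a^-1 * (score X eps j 0 - rootn^-1 * (lam j 0 * d j 0))) <=
   D * (a^-1 * (score X eps j 0 - rootn^-1 * r j 0)).
  move=> h; rewrite [leLHS]mulrCA [leRHS]mulrCA ler_pM2l//.
  rewrite !mulrBr lerD2l lerN2 mulrCA [leRHS]mulrCA ler_pM2l//.
case: ifPn => [ed|]; [split|rewrite -ltNge => ed; split].
- apply: scal; rewrite dj mulrCA dd mulr1.
  by rewrite (le_trans (ler_norm _))// normrM normr_sign mul1r.
- by rewrite mulrCA pmulr_rle0// mulrC -dj.
- suff rE : r j 0 = lam j 0 * d j 0 by apply: scal; rewrite rE.
  have bE : b j 0 = beta j 0 + rootn^-1 * e j 0.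
    have -> : e j 0 = rootn * (b j 0 - beta j 0) by rewrite !mxE.
    by rewrite mulrA mulVf ?gt_eqF// mul1r addrC subrK.
  have betad : 0 <= beta j 0 * d j 0.
    rewrite dj /s ffunE; case: ltP => [bn|bp]; last by rewrite mulr1.
    by rewrite expr1 mulrN1 oppr_ge0 ltW.
  have bd : 0 < b j 0 * d j 0.
    by rewrite bE mulrDl ltr_wpDl// -mulrA mulr_gt0.
  have nb : `|b j 0| = b j 0 * d j 0.
    by rewrite -[RHS]gtr0_norm// normrM dj normr_sign mulr1.
  have bn0 : b j 0 != 0 by apply: contraTneq bd => ->; rewrite mul0r ltxx.
  by apply: (mulIf bn0); rewrite rb nb; ring.
- rewrite mulrCA pmulr_rle0// signrN mulNr oppr_le0 mulrC -dj; exact: ltW.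
Qed.

(** Deep inside the orthant of [s] the error cannot change the sign of any
    coordinate, so that the orthant minimizer satisfies the stationarity
    conditions of the Lasso. *)
Lemma lasso_error_far (lam : 'cV[R]_p) (s : {ffun 'I_p -> bool})
    (eps : 'cV[R]_n) (N : R) :
  (forall j, 0 <= lam j 0) ->
  (forall j, 0 < N + sign_vec s j 0 * (rootn^-1 * u_hat X lam (sign_vec s) eps j 0)) ->
  lasso_error lam (N *: sign_vec s) eps = u_hat X lam (sign_vec s) eps.
Proof.
set d := sign_vec s; set uh := u_hat _ _ _ _ => l0 Nu.
pose beta := N *: d; pose b := beta + rootn^-1 *: uh.
suff bE : lasso X lam (X *m beta + eps) = b.
  by rewrite /lasso_error bE /b addrC addKr scalerA divff ?gt_eqF// scale1r.
apply: lasso_kkt_eq => // j.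
have dd : d j 0 * d j 0 = 1 :> R by rewrite sign_vecE -expr2 sqrr_sign.
have rE : (X^T *m (X *m beta + eps) - G *m b) j 0 = lam j 0 * d j 0.
  have -> : X^T *m (X *m beta + eps) - G *m b = rootn *: (score X eps - C *m uh).
    rewrite scalerBr /score scalerA divff ?gt_eqF// scale1r /gram_mx -scalemxAl.
    rewrite scalerA rnn.
    rewrite /b mulmxDr [G *m (_ + _)]mulmxDr mulmxA opprD addrA.
    by rewrite [_ + X^T *m eps]addrC addrK -[in LHS]scalemxAr.
  have -> (A B : 'cV[R]_p) : (rootn *: (A - B)) j 0 = rootn * (A j 0 - B j 0).
    by rewrite !mxE.
  rewrite gram_u_hat opprB addrC subrK.
  by rewrite mulrA divff ?gt_eqF// mul1r.
rewrite rE; split.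
  by rewrite normrM sign_vecE normr_sign mulr1 ger0_norm.
have bj : b j 0 = N * d j 0 + rootn^-1 * uh j 0.
  by rewrite /b /beta !mxE.
have bd : 0 < b j 0 * d j 0.
  by rewrite bj mulrDl -mulrA dd mulr1 [_ * d j 0]mulrC.
have nb : `|b j 0| = b j 0 * d j 0.
  by rewrite -[RHS]gtr0_norm// normrM sign_vecE normr_sign mulr1.
by rewrite nb; ring.
Qed.

End coverage.

(** * The law of the orthant minimizers *)
Section law_of_u_hat.
Context {R : realType}.

(** Membership in [a M] is membership of the quotient in [M] where [a] is nonzero;
    where [a = 0], it only asks whether [u = 0] and [M] is nonempty. *)
Lemma measurable_scaled_mem d (T : measurableType d) p (M : set 'cV[R]_p)
    (a : T -> R) (u : T -> 'cV[R]_p) :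
  measurable M -> (forall t, 0 <= a t) ->
  measurable_fun setT a -> measurable_fun setT u ->
  measurable [set t | [set a t *: m | m in M] (u t)].
Proof.
move=> mM a0 ma mu.
have ma0 : measurable (a @^-1` [set 0]).
  by have := ma measurableT _ (measurable_set1 0); rewrite setTI.
have mu0 : measurable (u @^-1` [set 0]).
  by have := mu measurableT _ (@measurable_set0col R p); rewrite setTI.
have mv : measurable_fun setT (fun t => (a t)^-1 *: u t).
  apply: measurable_fun_col => i; under eq_fun do rewrite mxE.
  apply: measurable_funM; first exact: measurable_inv_ge0.
  exact: measurableT_comp (measurable_coord i) mu.
have mM' : measurable ((fun t => (a t)^-1 *: u t) @^-1` M).
  by have := mv measurableT _ mM; rewrite setTI.
rewrite [X in measurable X](_ : _ =
    (~` (a @^-1` [set 0]) `&` (fun t => (a t)^-1 *: u t) @^-1` M) `|`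
    (a @^-1` [set 0] `&` u @^-1` [set 0] `&` [set _ | M !=set0])).
  apply: measurableU; first by apply: measurableI => //; exact: measurableC.
  apply: measurableI; first exact: measurableI.
  have [M0|M0] := pselect (M !=set0).
    by rewrite (_ : [set _ | _] = setT) //; apply/seteqP; split.
  by rewrite (_ : [set _ | _] = set0) //; apply/seteqP; split.
apply/seteqP; split=> t /=.
  have [at0|at0] := eqVneq (a t) 0.
    by rewrite at0 => -[m Mm <-]; right; rewrite scale0r; split => //; exists m.
  by move/(scale_setE _ _ at0) => Mu; left; split => //; exact/eqP.
case=> [[/eqP at0 Mu]|[[at0 ut0] [m Mm]]]; first exact/scale_setE.
by exists m => //; rewrite at0 ut0 scale0r.
Qed.

Lemma eq_probability_off d (T : measurableType d) (P : probability T R)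
    (A B N : set T) : measurable A -> measurable B -> measurable N ->
  P N = 0%E -> (forall t, ~ N t -> (A t <-> B t)) -> P A = P B.
Proof.
move=> mA mB mN N0 AB.
have off (C : set T) : measurable C -> P C = P (C `\` N).
  move=> mC; rewrite (measureDI P mC mN) [X in (_ + X)%E](_ : _ = 0%E) ?adde0//.
  by apply: (subset_measure0 (B := N)) => //; exact: measurableI.
rewrite (off A)// (off B)//; congr (P _).
by apply/seteqP; split=> t [Ct Nt]; split => //; exact/(AB _ Nt).
Qed.

Section u_hat.
Context (n p : nat) (X : 'M[R]_(n, p)) (rankX : \rank X = p) (n0 : (0 < n)%N).
Local Notation G := (X^T *m X).
Local Notation C := (gram_mx X).
Local Notation rootn := (Num.sqrt n%:R : R).

(** The location parameter of the t distribution that belongs to the signs [d]. *)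
Definition t_loc (gamma d : 'cV[R]_p) : 'cV[R]_p :=
  - (rootn^-1 *: (invmx C *m diag_mx gamma^T *m d)).

(** The penalty is proportional to the scale estimate [a], so dividing by [a]
    turns its contribution into the constant [t_loc]. *)
Lemma u_hat_split a gamma d x :
  u_hat X (a *: gamma) d x =
  rootn *: (invmx G *m (X^T *m x)) + a *: t_loc gamma d.
Proof.
have nR0 : n%:R != 0 :> R by rewrite pnatr_eq0 -lt0n.
rewrite u_hatE// mulmxBr; congr (_ + _); last first.
  have -> : diag_mx (a *: gamma)^T = a *: diag_mx gamma^T.
    by apply/matrixP => i j; rewrite !mxE mulrnAr.
  rewrite -scalemxAl -!scalemxAr /t_loc scalerN.
  by rewrite !scalerA mulmxA [rootn^-1 * a]mulrC.
rewrite /gram_mx invmxZ; last exact: gram_mx_unit.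
rewrite invrK /score -scalemxAl -scalemxAr scalerA; congr (_ *: _).
have rnE : rootn ^+ 2 = n%:R by rewrite sqr_sqrtr.
rewrite -[X in X / _]rnE expr2 mulfK// gt_eqF// sqrtr_gt0 ltr0n//.
Qed.

Lemma measurable_u_hat d (T : measurableType d) (a : T -> R)
    (y : T -> 'cV[R]_n) gamma dv :
  measurable_fun setT a -> measurable_fun setT y ->
  measurable_fun setT (fun t => u_hat X (a t *: gamma) dv (y t)).
Proof.
move=> ma my; apply: measurable_fun_col => i.
have -> : (fun t => u_hat X (a t *: gamma) dv (y t) i 0) =
    (fun t => ((rootn *: (invmx G *m X^T)) *m y t + 0) i 0 + a t * t_loc gamma dv i 0).
  apply/funext => t; rewrite u_hat_split addr0 [LHS]mxE; congr (_ + _); last by rewrite mxE.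
  by rewrite -scalemxAl mulmxA.
apply: measurable_funD; last exact: measurable_funM.
exact: (measurableT_comp (measurable_coord i) (measurableT_comp (measurable_affine _ _) my)).
Qed.

End u_hat.

(** Off the null event that the scale estimate vanishes, the event says that the
    studentized vector [tstat] lies in [M]. *)
Lemma u_hat_law (n p : nat) (pn : (p < n)%N)
    (X : 'M[R]_(n, p)) (rankX : \rank X = p) (s2 : R)
    (d : measure_display) (Omega : measurableType d) (P : probability Omega R)
    (eps : {RV P >-> 'cV[R]_n})
    (eps_normal : forall A : set 'cV[R]_n, measurable A ->
      distribution P eps A = mvnormal_prob 0 s2%:M A)
    (gamma dv : 'cV[R]_p) (M : set 'cV[R]_p) (mM : measurable M) :
  P [set w | [set sigma_hat X (eps w) *: m | m in M]
       (u_hat X (sigma_hat X (eps w) *: gamma) dv (eps w))] =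
  mvt_prob (n - p) (t_loc X gamma dv) (invmx (gram_mx X)) M.
Proof.
have [k k0 nE] : exists2 k, (0 < k)%N & n = (p + k)%N.
  by exists (n - p)%N; rewrite ?subn_gt0// subnKC// ltnW.
subst n; rewrite addKn.
have [B [XB rankB]] := orthogonal_complement rankX.
move: B XB rankB; rewrite addKn => B XB rankB.
have n0 : (0 < p + k)%N by rewrite addn_gt0 k0 orbT.
have ms := measurable_sigma_hat rankX.
have meps : measurable_fun setT eps by [].
have total : mvnormal_prob 0 s2%:M [set: 'cV[R]_(p + k)] = 1%E.
  by rewrite -eps_normal// /distribution /pushforward preimage_setT probability_setT.
rewrite -(tstat_law rankX k0 XB rankB _ total mM).
have mt : measurable (tstat X (t_loc X gamma dv) @^-1` M).
  have := measurable_tstat rankX (t_loc X gamma dv) measurableT mM.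
  by rewrite setTI.
rewrite -eps_normal//.
have mN : measurable (eps @^-1` [set x | sigma_hat X x = 0]).
  rewrite -[X in measurable X]setTI; apply: meps => //.
  by have := ms measurableT _ (measurable_set1 0); rewrite setTI.
apply: (eq_probability_off (N := eps @^-1` [set x | sigma_hat X x = 0])) => //.
- apply: measurable_scaled_mem => //.
  + by move=> w; exact: sigma_hat_ge0.
  + exact: measurableT_comp ms meps.
  + by apply: measurable_u_hat => //; exact: measurableT_comp ms meps.
- by rewrite -[X in measurable X]setTI; exact: meps.
- have := sigma_hat_null rankX k0 s2 XB rankB.
  rewrite -eps_normal//.
  by have := ms measurableT _ (measurable_set1 0); rewrite setTI.
move=> w /= /eqP sw0.
have -> : tstat X (t_loc X gamma dv) (eps w) =
    (sigma_hat X (eps w))^-1 *: u_hat X (sigma_hat X (eps w) *: gamma) dv (eps w).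
  by rewrite u_hat_split// scalerDr !scalerA mulVf// scale1r mulrC.
exact: scale_setE.
Qed.

End law_of_u_hat.

(** * Coverage probabilities *)
Lemma mem_shift_scaleE (R : realType) p (M : set 'cV[R]_p) (r a : R) (l b : 'cV[R]_p) :
  r != 0 ->
  [set l - (r^-1 * a) *: m | m in M] b <-> [set a *: m | m in M] (r *: (l - b)).
Proof.
move=> r0; split=> -[m Mm E]; exists m => //.
  by rewrite -E opprB addrC subrK scalerA mulrA divff// mul1r.
by rewrite -scalerA E scalerA mulVf// scale1r opprB addrC subrK.
Qed.

Section coverage_probability.
Context {R : realType} (n p : nat) (X : 'M[R]_(n, p)).
Context (rankX : \rank X = p) (n0 : (0 < n)%N).
Context (d : measure_display) (Omega : measurableType d) (P : probability Omega R).
Context (eps : Omega -> 'cV[R]_n) (meps : measurable_fun setT eps).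
Context (gamma : 'cV[R]_p) (gamma_ge0 : forall j, 0 <= gamma j 0).
Context (M : set 'cV[R]_p) (mM : measurable M) (condM : conditionA (gram_mx X) M).

Let sg w := sigma_hat X (eps w).
Let sg0 w : 0 <= sg w. Proof. exact: sigma_hat_ge0. Qed.
Let msg : measurable_fun setT sg.
Proof. exact: measurableT_comp (measurable_sigma_hat rankX) meps. Qed.
Let lam0 w j : 0 <= (sg w *: gamma) j 0.
Proof. by rewrite mxE mulr_ge0. Qed.

Let E beta : set Omega :=
  [set w | [set sg w *: m | m in M] (lasso_error X (sg w *: gamma) beta (eps w))].
Let F s : set Omega :=
  [set w | [set sg w *: m | m in M] (u_hat X (sg w *: gamma) (sign_vec s) (eps w))].

Lemma measurable_lasso_event beta : measurable (E beta).
Proof.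
apply: measurable_scaled_mem => //.
have my : measurable_fun setT (fun w => X *m beta + eps w).
  have := measurableT_comp (measurable_affine 1%:M (X *m beta)) meps.
  by congr measurable_fun; apply/funext => w /=; rewrite mul1mx addrC.
have ml : measurable_fun setT (fun w => sg w *: gamma).
  by apply: measurable_fun_col => i; under eq_fun do rewrite mxE; exact: measurable_funM.
have mla := measurable_lasso rankX lam0 ml my.
have := measurableT_comp (measurable_affine (Num.sqrt n%:R)%:M
  (- (Num.sqrt n%:R *: beta))) mla.
by congr measurable_fun; apply/funext => w /=; rewrite mul_scalar_mx /lasso_error scalerBr.
Qed.

Lemma measurable_u_event s : measurable (F s).
Proof. by apply: measurable_scaled_mem => //; exact: measurable_u_hat. Qed.

Lemma lasso_coverage_ge (beta : 'cV[R]_p) :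
  (P (F [ffun j => beta j 0 < 0]%R) <= P (E beta))%E.
Proof.
apply: le_measure; rewrite ?inE.
- exact: measurable_u_event.
- exact: measurable_lasso_event.
by move=> w; exact: coverage_lower.
Qed.

(** Along [beta = k * sign_vec s], with [k] tending to infinity, the Lasso error
    equals the orthant minimizer except on events [N k] that decrease to the
    empty set. *)
Lemma lasso_coverage_inf_le s : (ereal_inf (range (P \o E)) <= P (F s))%E.
Proof.
pose u w := u_hat X (sg w *: gamma) (sign_vec s) (eps w).
have mu : measurable_fun setT u by exact: measurable_u_hat.
(* If [V w < k], no coordinate of the rescaled minimizer reaches [k]. *)
pose V w := \sum_j `|(Num.sqrt n%:R)^-1 * u w j 0|.
have mV : measurable_fun setT V.
  apply: measurable_sum => j; apply: measurableT_comp => //.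
  by apply: measurable_funM => //; exact: measurableT_comp (measurable_coord j) mu.
pose N (k : nat) := V @^-1` `[k%:R, +oo[.
have mN k : measurable (N k).
  by have := mV measurableT _ (measurable_itv `[k%:R, +oo[); rewrite setTI.
have capN : \bigcap_k N k = set0.
  apply/seteqP; split=> // w /(_ (Num.truncn (V w)).+1 I).
  by rewrite /N /= in_itv/= andbT leNgt truncnS_gt.
have N0 : P (N k) @[k --> \oo] --> 0%E.
  rewrite -(measure0 P) -capN; apply: nonincreasing_cvg_mu => //.
  - by rewrite (le_lt_trans (probability_le1 _ _)) ?ltry.
  - exact: bigcap_measurable.
  move=> j k jk; apply/subsetPset => w; rewrite /N /= !in_itv/= !andbT.
  by apply: le_trans; rewrite ler_nat.
have EN k : (ereal_inf (range (P \o E)) <= P (F s) + P (N k))%E.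
  apply: (@le_trans _ _ (P (E (k%:R *: sign_vec s)))).
    by apply: ereal_inf_lbound; exists (k%:R *: sign_vec s).
  apply: le_trans (measureU2 _ _ _) => //; last exact: measurable_u_event.
  apply: le_measure; rewrite ?inE.
  - exact: measurable_lasso_event.
  - by apply: measurableU => //; exact: measurable_u_event.
  move=> w Ew; have [Vk|Vk] := leP k%:R (V w).
    by right; rewrite /N /= in_itv/= Vk.
  left; rewrite /F /=; move: Ew; rewrite /E /= lasso_error_far// => j.
  rewrite -ltrBlDl sub0r ltrNl; apply: le_lt_trans Vk.
  rewrite (le_trans (ler_norm _))// normrN normrM sign_vecE normr_sign mul1r.
  by rewrite /V (bigD1 j)//= lerDl sumr_ge0.
have cv : (fun k => P (F s) + P (N k))%E @ \oo --> (P (F s) + 0)%E.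
  by apply: cvgeD => //; [rewrite fin_num_adde_defl|exact: cvg_cst].
rewrite -[leRHS]adde0 -(cvg_lim _ cv)//.
apply: lime_ge; first by apply/cvg_ex; exists (P (F s) + 0)%E.
by apply: nearW => k; exact: EN.
Qed.

Lemma lasso_coverage_inf :
  ereal_inf (range (fun beta => P (E beta))) =
  \big[Order.min/+oo%E]_(s : {ffun 'I_p -> bool}) P (F s).
Proof.
apply/eqP; rewrite eq_le; apply/andP; split.
  by apply/bigmin_geP; split; [exact: leey|move=> s _; exact: lasso_coverage_inf_le].
apply: le_ereal_inf_tmp => _ [beta _ <-].
apply: le_trans (lasso_coverage_ge beta); exact: bigmin_le.
Qed.

End coverage_probability.

Theorem corollary7 (R : realType) (n p : nat) (pn : (p < n)%N)
    (X : 'M[R]_(n, p)) (rankX : \rank X = p)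
    (sigma2 : R) (sigma2_gt0 : 0 < sigma2)
    (d : measure_display) (Omega : measurableType d) (P : probability Omega R)
    (eps : {RV P >-> 'cV[R]_n})
    (eps_normal : forall A : set 'cV[R]_n, measurable A ->
      distribution P eps A = mvnormal_prob 0 sigma2%:M A)
    (gamma : 'cV[R]_p) (gamma_ge0 : forall j, 0 <= gamma j 0)
    (M : set 'cV[R]_p) (mM : measurable M)
    (condM : conditionA (gram_mx X) M) :
  let y (beta : 'cV[R]_p) (w : Omega) : 'cV[R]_n := X *m beta + eps w in
  let sigmah (beta : 'cV[R]_p) (w : Omega) : R := sigma_hat X (y beta w) in
  let lambda (beta : 'cV[R]_p) (w : Omega) : 'cV[R]_p :=
    sigmah beta w *: gamma in
  let rootn : R := Num.sqrt n%:R in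
  forall beta0 : 'cV[R]_p,
    ereal_inf (range (fun beta : 'cV[R]_p =>
      P [set w | [set lasso X (lambda beta w) (y beta w)
                        - (rootn^-1 * sigmah beta w) *: m | m in M] beta])) =
    \big[Order.min/+oo%E]_(s : {ffun 'I_p -> bool})
      P [set w | [set sigmah beta0 w *: m | m in M]
                   (u_hat X (lambda beta0 w) (sign_vec s) (eps w))]
    /\
    \big[Order.min/+oo%E]_(s : {ffun 'I_p -> bool})
      P [set w | [set sigmah beta0 w *: m | m in M]
                   (u_hat X (lambda beta0 w) (sign_vec s) (eps w))] =
    \big[Order.min/+oo%E]_(s : {ffun 'I_p -> bool})
      mvt_prob (n - p)
        (- (rootn^-1 *: (invmx (gram_mx X) *m diag_mx gamma^T *m sign_vec s)))
        (invmx (gram_mx X)) M.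
Proof.
move=> y sigmah lambda rootn beta0.
have n0 : (0 < n)%N by exact: leq_ltn_trans pn.
have sE beta w : sigmah beta w = sigma_hat X (eps w) by exact: sigma_hat_shift.
have rn0 : rootn != 0 by rewrite gt_eqF// sqrtr_gt0 ltr0n.
have meps : measurable_fun setT eps by [].
have FE s : [set w | [set sigmah beta0 w *: m | m in M]
      (u_hat X (lambda beta0 w) (sign_vec s) (eps w))] =
    [set w | [set sigma_hat X (eps w) *: m | m in M]
      (u_hat X (sigma_hat X (eps w) *: gamma) (sign_vec s) (eps w))].
  by apply/seteqP; split=> w; rewrite /= /lambda sE.
under [in X in _ = X /\ _]eq_bigr do rewrite FE.
under [in X in _ /\ X = _]eq_bigr do rewrite FE.
split; last by apply: eq_bigr => s _;
  exact: (u_hat_law pn rankX eps_normal gamma (sign_vec s) mM).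
rewrite -(lasso_coverage_inf rankX n0 P meps gamma_ge0 mM condM).
apply: (congr1 (fun f => ereal_inf (range f))); apply/funext => beta.
apply: (congr1 P).
apply/seteqP; split=> w; rewrite /= /lambda sE => h.
  exact: (iffLR (mem_shift_scaleE _ _ _ _ rn0) h).
exact: (iffRL (mem_shift_scaleE _ _ _ _ rn0) h).
Qed.
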